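(* Let $g=(g_t)_{t\in\mathbb{Z}}\in\mathbb{C}^{\mathbb{Z}}$, let $A:=H^g(1,M,N)\in\mathbb{C}^{M\times N}$ and $k\le\min\{M,N\}$. For integer tuples $i=(i_1,\dots,i_k)$ put $$b^g_{(i_1,\dots,i_k)}:=\det\big(g_{i_j+l-1}\big)_{l,j=1}^k=\begin{vmatrix}g_{i_1}&\cdots&g_{i_k}\\ \vdots&&\vdots\\ g_{i_1+k-1}&\cdots&g_{i_k+k-1}\end{vmatrix}.$$ Let $s=(s_1<\dots<s_k)$ with $s_j\in(1:M)$ and $r=(r_1<\dots<r_k)$ with $r_j\in(1:N)$, and let $A_{(s,r)}$ be the submatrix of $A$ with rows $s$ and columns $r$. Define $\lambda_i:=s_{k-i+1}-(k-i+1)$, $\varepsilon_i:=r_{k-i+1}-k+i$, and for a $k$-tuple $v^\ast$, $\gamma_i(v^\ast):=v^\ast_{k-i+1}-k+i$, $i\in(1:k)$, and $$V^\ast:=\big\{(p+r)^\uparrow:\ p\in\mathcal{P}(\mu),\ \mu\in\mathcal{D}_\lambda,\ (p+r)^\uparrow_i>(p+r)^\uparrow_{i-1}\text{ for all }i\in(2:k)\big\}.$$ Then $$|A_{(s,r)}|=\sum_{v^\ast\in V^\ast}c^{\gamma(v^\ast)}_{\lambda,\varepsilon}\,b^g_{v^\ast}.$$ In particular, if the reshaped Hankel matrix $H^g(1,k,M+N-k)$ is (strictly) $k$-sign consistent, i.e. all $b^g_{(i_1,\dots,i_k)}$ with $1\le i_1<\dots<i_k\le M+N-k$ share the same (strict)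 sign, then $A$ is (strictly) $k$-sign consistent.
   Context: For $t\in\mathbb{Z}$, $m,n\ge1$, $H^g(t,m,n)$ is the $m\times n$ Hankel matrix with $(i,j)$ entry $g_{t+i+j-2}$. $|X|$ is the determinant. Tuples are added entrywise; $u^\uparrow$ is $u$ sorted in non-decreasing order. $\mathcal{D}_\lambda$ is the set of weakly decreasing $k$-tuples of nonnegative integers with the same sum as $\lambda$; $\mathcal{P}(\mu)$ is the set of all distinct rearrangements of $\mu$. $c^\gamma_{\lambda,\varepsilon}$ is the Littlewood–Richardson coefficient: the number of skew semistandard tableaux of shape $\gamma/\lambda$ (zero if the diagram of $\lambda$ is not contained in that of $\gamma$) with weight $\varepsilon$ (value $i$ used $\varepsilon_i$ times, weakly increasing along rows, strictly increasing down columns) whose right-to-left, top-to-bottom reading word is a lattice word (each prefix contains $i$ at least as often as $i+1$); equivalently the coefficient of $s_\gamma$ in $s_\lambda s_\varepsilon$ for Schur polynomials. A matrix is (strictly) $k$-sign consistent if all its $k\times k$ minors are $\ge0$ or all are $\le0$ (strictly: all $>0$ or all $<0$). *)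

(* Defs.v *)
From HB Require Import structures.
From mathcomp Require Import all_boot all_order all_algebra.
From mathcomp Require Import boolp classical_sets functions cardinality fsbigop.
From mathcomp Require Import reals complex.

Set Implicit Arguments.
Unset Strict Implicit.
Unset Printing Implicit Defensive.

Import Order.TTheory GRing.Theory Num.Theory.

Local Open Scope classical_set_scope.
Local Open Scope ring_scope.

(* Ordinals are 0-based: row i and column j stand for the 1-based indices     *)
(* i + 1 and j + 1, so that g_(t + (i + 1) + (j + 1) - 2) = g_(t + i + j).    *)
Definition hankel (C : Type) (g : int -> C) (t : int) (m n : nat) :
    'M[C]_(m, n) :=
  \matrix_(i < m, j < n) g (t + i%:Z + j%:Z).

Definition bdet (C : comPzRingType) (g : int -> C) (k : nat)
    (v : k.-tuple int) : C :=
  \det (\matrix_(l < k, j < k) g (tnth v j + l%:Z)).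

Definition increasing (k m : nat) (f : 'I_k -> 'I_m) : Prop :=
  forall i j : 'I_k, (i < j)%N -> (f i < f j)%N.

Definition one_based (k m : nat) (f : 'I_k -> 'I_m) : k.-tuple nat :=
  [tuple (f j).+1 | j < k].

(* On complex numbers, 0 <= z means that z is real and nonnegative.           *)
Definition share_sign (C : numDomainType) (T : Type) (D : set T) (x : T -> C) :
    Prop :=
  (forall i, D i -> 0 <= x i) \/ (forall i, D i -> x i <= 0).

Definition share_strict_sign (C : numDomainType) (T : Type) (D : set T)
    (x : T -> C) : Prop :=
  (forall i, D i -> 0 < x i) \/ (forall i, D i -> x i < 0).

Definition minor_indices (k m n : nat) :
    set (('I_k -> 'I_m) * ('I_k -> 'I_n)) :=
  [set f | increasing f.1 /\ increasing f.2].
Arguments minor_indices : clear implicits.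

Definition minor (C : comPzRingType) (k m n : nat) (A : 'M[C]_(m, n))
    (f : ('I_k -> 'I_m) * ('I_k -> 'I_n)) : C :=
  \det (mxsub f.1 f.2 A).

Definition sign_consistent (C : numDomainType) (k m n : nat)
    (A : 'M[C]_(m, n)) : Prop :=
  share_sign (minor_indices k m n) (minor A).

Definition strictly_sign_consistent (C : numDomainType) (k m n : nat)
    (A : 'M[C]_(m, n)) : Prop :=
  share_strict_sign (minor_indices k m n) (minor A).

Local Open Scope nat_scope.

(* Tuples of naturals: entry number i (0-based) is the entry of index i + 1   *)
(* in 1-based notation, and rev_ord turns this index into k - (i + 1) + 1.    *)
Definition lambda_of (k : nat) (s : k.-tuple nat) : k.-tuple nat :=
  [tuple tnth s (rev_ord i) - (rev_ord i).+1 | i < k].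

(* The truncated subtraction is exact on strictly increasing positive v.      *)
Definition gamma_of (k : nat) (v : k.-tuple nat) : k.-tuple nat :=
  [tuple tnth v (rev_ord i) - rev_ord i | i < k].

Definition epsilon_of (k : nat) (r : k.-tuple nat) : k.-tuple nat :=
  gamma_of r.

Definition tuple_add (k : nat) (p r : k.-tuple nat) : k.-tuple nat :=
  [tuple tnth p i + tnth r i | i < k].

Definition sort_up (k : nat) (u : k.-tuple nat) : k.-tuple nat :=
  [tuple of sort leq u].

Definition decr_tuples (k : nat) (lam : k.-tuple nat) : set (k.-tuple nat) :=
  [set mu : k.-tuple nat | sorted geq mu /\ sumn mu = sumn lam].

Definition rearrangements (k : nat) (mu : k.-tuple nat) : set (k.-tuple nat) :=
  [set p : k.-tuple nat | perm_eq p mu].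

Definition Vstar (k : nat) (lam r : k.-tuple nat) : set (k.-tuple nat) :=
  [set v : k.-tuple nat | exists mu p : k.-tuple nat,
    [/\ decr_tuples lam mu, rearrangements mu p,
        v = sort_up (tuple_add p r) & sorted ltn v]].

(* fsbigop sums over an infinite set default to 0; Vstar is finite, so a sum  *)
(* over it is a genuine one.                                                  *)
Lemma finite_Vstar (k : nat) (lam r : k.-tuple nat) :
  finite_set (Vstar lam r).
Proof.
pose B := (sumn lam + sumn r).+1.
pose f (u : k.-tuple 'I_B) : k.-tuple nat := map_tuple (@nat_of_ord B) u.
apply: (@sub_finite_set _ _ [set f u | u in [set: k.-tuple 'I_B]]); last first.
  exact: finite_image.
have le_sumn (s : seq nat) x : x \in s -> x <= sumn s.
  elim: s => //= a s IHs; rewrite inE => /orP[/eqP->|/IHs]; first exact: leq_addr.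
  by move=> /leq_trans; apply; exact: leq_addl.
move=> v [mu] [p] [[_ smu] pmu -> _] /=; set w := sort_up _.
have wB x : x \in w -> x < B.
  rewrite mem_sort => /tnthP[i ->]; rewrite tnth_mktuple /B ltnS leq_add //.
    by rewrite -smu -(perm_sumn pmu) le_sumn // mem_tnth.
  by rewrite le_sumn // mem_tnth.
exists (map_tuple (@inord _) w) => //; apply: val_inj => /=.
rewrite -map_comp -[RHS]map_id; apply/eq_in_map => x xw /=.
by rewrite inordK // wB.
Qed.

(* The diagram of gam / lam; (i, j) is the cell in row i + 1, column j + 1.   *)
Definition skew_cell (k : nat) (gam lam : k.-tuple nat) : finType :=
  {c : 'I_k * 'I_(\max_(i < k) tnth gam i) |
     tnth lam c.1 <= c.2 < tnth gam c.1}.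

(* The value a : 'I_k stands for the entry a + 1; larger entries cannot occur *)
(* in a tableau whose weight is a k-tuple.                                    *)
Definition filling (k : nat) (gam lam : k.-tuple nat) : finType :=
  {ffun skew_cell gam lam -> 'I_k}.

Definition semistandard (k : nat) (gam lam : k.-tuple nat)
    (T : filling gam lam) : bool :=
  [forall c : skew_cell gam lam, forall d : skew_cell gam lam,
     (((val c).1 == (val d).1) && ((val c).2 <= (val d).2) ==> (T c <= T d)) &&
     (((val c).2 == (val d).2) && ((val c).1 < (val d).1) ==> (T c < T d))].

Definition has_weight (k : nat) (gam lam : k.-tuple nat)
    (T : filling gam lam) (eps : k.-tuple nat) : bool :=
  [forall a : 'I_k, #|[pred c | T c == a]| == tnth eps a].

(* Right to left in each row, rows from top to bottom.                        *)
Definition reading_leq (k : nat) (gam lam : k.-tuple nat) :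
    rel (skew_cell gam lam) :=
  fun c d => ((val c).1 < (val d).1)
          || (((val c).1 == (val d).1) && ((val d).2 <= (val c).2)).

Definition reading_word (k : nat) (gam lam : k.-tuple nat)
    (T : filling gam lam) : seq nat :=
  [seq val (T c) | c <- sort (@reading_leq k gam lam) (enum (skew_cell gam lam))].

(* For words on the letters 0, ..., k - 1.                                    *)
Definition lattice_word (k : nat) (w : seq nat) : bool :=
  all (fun n => all (fun a =>
         count_mem a.+1 (take n w) <= count_mem a (take n w)) (iota 0 k))
      (iota 0 (size w).+1).

Definition LR_coef (k : nat) (gam lam eps : k.-tuple nat) : nat :=
  if [forall i : 'I_k, tnth lam i <= tnth gam i] then
    #|[pred T : filling gam lam |
        [&& semistandard T, has_weight T eps
          & lattice_word k (reading_word T)]]|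
  else 0.

Definition increasing_tuples (k L : nat) : set (k.-tuple nat) :=
  [set i : k.-tuple nat | sorted ltn i /\ all (fun x => 1 <= x <= L) i].
Arguments increasing_tuples : clear implicits.

(* Main.v *)
Require Import Defs.
From HB Require Import structures.
From mathcomp Require Import all_boot all_order all_algebra all_fingroup.
From mathcomp Require Import finmap boolp classical_sets functions cardinality.
From mathcomp Require Import fsbigop reals complex zify.

(** Write [h_l(n) = g(n + s_l - 1)]. The minor is [det (h_l (r_j))], and
    [r_j = eps_(k+1-j) + j - 1], so by the bialternant formula
    [a_(eps + delta) = s_eps a_delta] it is a sum of determinants [b^g] over
    the Gelfand-Tsetlin patterns with top row [eps]: the pattern of weight [w]
    contributes [b^g] at [lam + w + delta] (sorted increasingly).
    Since [b^g] is alternating, the patterns violating the Littlewood-Richardson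
    dominance condition cancel in pairs: at the first violation, one level
    [mid] of the pattern, lying between [dn] and [up], is reflected from the
    violating index onwards inside the box of values allowed by interlacing,
    which swaps two entries of [lam + w + delta]. The same cancellation for
    [lam = 0] leaves a single pattern and proves the bialternant formula, and
    reflecting a whole level (Bender-Knuth) shows that weights are
    symmetrically distributed.
    The surviving patterns of weight [gamma - lam] are the LR
    tableaux of shape [gamma / lam] and weight [eps]: level [j], index [i] of the
    pattern counts the entries [i] in the first [j] rows. Each of them satisfies
    [eps <= gamma] and [gamma_1 <= lam_1 + eps_1], which places the tuple in
    [V*] and in the range of the reshaped Hankel matrix, and the pattern of
    weight [eps] always survives, whence strictness. *)

Set Implicit Arguments.
Unset Strict Implicit.
Unset Printing Implicit Defensive.

Import Order.TTheory GRing.Theory Num.Theory.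
Local Open Scope classical_set_scope.
Local Open Scope nat_scope.

(** * Reflecting one level of a pattern *)

Definition psum (f : nat -> nat) (n : nat) : nat := \sum_(i < n) f i.

Lemma psum0 f : psum f 0 = 0.
Proof. by rewrite /psum big_ord0. Qed.

Lemma psumS f n : psum f n.+1 = psum f n + f n.
Proof. by rewrite /psum big_ord_recr. Qed.

Lemma eq_psum f h n : (forall i, i < n -> f i = h i) -> psum f n = psum h n.
Proof. by move=> fh; apply: eq_bigr => i _; exact: fh. Qed.

Definition interlace (mid up : nat -> nat) : Prop :=
  forall i, up i.+1 <= mid i <= up i.

Section OneLevel.
Variables (up dn : nat -> nat).

(** Interlacing with both neighbours is a box condition: entry [i] ranges from [lower i] to
    [upper i] independently of the other entries, so entries can be moved one by one. *)
Definition lower i := maxn (up i.+1) (dn i).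
Definition upper i := if i is i'.+1 then minn (up i) (dn i') else up 0.

Definition flip (mid : nat -> nat) : nat -> nat :=
  fun i => lower i + upper i - mid i.

Lemma interlace_bounds mid : interlace mid up -> interlace dn mid ->
  forall i, lower i <= mid i <= upper i.
Proof.
move=> hu hd i; rewrite /lower /upper.
by have := hu i; have := hd i; case: i => [|i]; [|have := hd i]; lia.
Qed.

Lemma bounds_interlace mid : (forall i, lower i <= mid i <= upper i) ->
  interlace mid up /\ interlace dn mid.
Proof.
move=> h; split=> i.
  by have := h i; rewrite /lower /upper; case: i => [|i]; lia.
by have := h i; have := h i.+1; rewrite /lower /=; lia.
Qed.

Lemma flip_bounds mid : (forall i, lower i <= mid i <= upper i) ->
  forall i, lower i <= flip mid i <= upper i.
Proof. by move=> h i; have := h i; rewrite /flip; lia. Qed.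

Lemma flipK mid : (forall i, lower i <= mid i <= upper i) ->
  forall i, flip (flip mid) i = mid i.
Proof. by move=> h i; have := h i; rewrite /flip; lia. Qed.

(* [max a b + min a b = a + b] makes the sum telescope. *)
Lemma psum_flip mid n : (forall i, lower i <= mid i <= upper i) ->
  psum mid n + psum (flip mid) n + upper n = psum up n + psum dn n + up n.
Proof.
move=> h; elim: n => [|n IH]; first by rewrite !psum0.
have e : flip mid n = lower n + upper n - mid n by [].
have := h n; move: IH e; rewrite !psumS /lower /=; lia.
Qed.

(** * Reflection at the first violation of dominance *)

Variables (l l' : nat).

(** Column strictness in additive form: if two consecutive rows start at columns [l] and [l'], the
    entries [< i.+1] of the lower row end no later than the entries [< i] of the upper row. *)
Definition dominates (mid : nat -> nat) i : bool :=
  l' + psum up i.+1 + psum dn i <= l + psum mid i + psum mid i.+1.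

(** When the subtraction is exact, dominance at [i] reads [up i <= mid i + slack mid i]. Only
    entries of [mid] before [i] enter, so a reflection from [i] onwards preserves the slack. *)
Definition slack (mid : nat -> nat) i : nat :=
  l + psum mid i + psum mid i - (l' + psum up i + psum dn i).

(** At [i0] the reflection takes place inside the violating part of the box, which ends at
    [(up i0 - slack mid i0).-1], so that the violation persists; later entries use their whole
    box. *)
Definition reflect_from i0 (mid : nat -> nat) : nat -> nat :=
  fun i => if i < i0 then mid i
           else if i == i0 then lower i0 + (up i0 - slack mid i0).-1 - mid i0
           else flip mid i.

Hypothesis ll' : l' <= l.

Variables (mid : nat -> nat) (i0 : nat).
Hypothesis bnd : forall i, lower i <= mid i <= upper i.
Hypothesis dom : forall i, i < i0 -> dominates mid i.
Hypothesis ndom : ~~ dominates mid i0.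

(** Dominance at [i0.-1] gives [slack mid i0 >= mid i0.-1 - dn i0.-1]; together with
    [up i0 <= mid i0.-1] this keeps the violating values within the box. For [i0 = 0] the hypothesis
    [l' <= l] suffices. *)
Lemma reflect_from_fact :
  [/\ slack mid i0 + (l' + psum up i0 + psum dn i0) =
        l + psum mid i0 + psum mid i0,
      mid i0 + slack mid i0 < up i0
    & up i0 - slack mid i0 <= upper i0].
Proof.
have [iu id] := bounds_interlace bnd.
move: ndom; rewrite /dominates !psumS -ltnNge /slack => nd.
case: i0 dom nd => [|j] dm nd; first by move: nd; rewrite /= !psum0; split; lia.
have := dm j (ltnSn j); have := iu j; have := id j.
have := bnd j; have := bnd j.+1; move: nd.
by rewrite /dominates /lower /= !psumS; split; lia.
Qed.

Lemma reflect_from_bounds :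
  forall i, lower i <= reflect_from i0 mid i <= upper i.
Proof.
move=> i; have [h1 h2 h3] := reflect_from_fact; rewrite /reflect_from.
case: ltngtP => [//|_|->]; first exact: flip_bounds.
by have := bnd i0; lia.
Qed.

Lemma psum_reflect_lt n : n <= i0 -> psum (reflect_from i0 mid) n = psum mid n.
Proof.
by move=> ni; apply: eq_psum => i ilt; rewrite /reflect_from (leq_trans ilt ni).
Qed.

Lemma slack_reflect : slack (reflect_from i0 mid) i0 = slack mid i0.
Proof. by rewrite /slack psum_reflect_lt. Qed.

Lemma reflect_ndominates : ~~ dominates (reflect_from i0 mid) i0.
Proof.
have [h1 h2 h3] := reflect_from_fact.
rewrite /dominates !psumS psum_reflect_lt // /reflect_from ltnn eqxx.
by have := bnd i0; lia.
Qed.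

Lemma reflectK i : reflect_from i0 (reflect_from i0 mid) i = mid i.
Proof.
have [h1 h2 h3] := reflect_from_fact.
rewrite {1}/reflect_from slack_reflect; case: ltngtP => [ilt|igt|->].
- by rewrite /reflect_from ilt.
- by rewrite /flip /reflect_from ltnNge (ltnW igt) /= gtn_eqF // /flip; have := bnd i; lia.
- by rewrite /reflect_from ltnn eqxx; have := bnd i0; lia.
Qed.

(** The sum telescopes as for [flip], but the shortened interval at [i0] brings in [l + 1] against
    [l']. The 1 is the difference of consecutive entries of delta, so entries of [lam + w + delta]
    are exchanged instead of weights. *)
Lemma psum_reflect n : i0 < n ->
  psum mid n + psum (reflect_from i0 mid) n + l + upper n + 1 =
  psum up n + psum dn n + l' + up n.
Proof.
have [h1 h2 h3] := reflect_from_fact.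
elim: n => [//|n IH]; rewrite ltnS leq_eqVlt => /orP[/eqP<-|/[dup] ilt /IH].
  rewrite !psumS psum_reflect_lt // {1}/reflect_from ltnn eqxx /=.
  have := bnd i0; rewrite /lower; lia.
have e : reflect_from i0 mid n = lower n + upper n - mid n.
  by rewrite /reflect_from ltnNge (ltnW ilt) /= gtn_eqF.
rewrite !psumS e /lower /=; have := bnd n; rewrite /lower; lia.
Qed.

End OneLevel.

(** * Gelfand-Tsetlin patterns *)

Section GelfandTsetlin.
Variables (k : nat) (e : nat -> nat).
Hypothesis e_out : forall i, k <= i -> e i = 0.

(** Levels are infinite sequences. The triangular shape comes from level 0 being zero together with
    interlacing, and vanishing above level [k] makes [f] determined by finitely many values. *)
Definition gt_pattern (f : nat -> nat -> nat) : Prop :=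
  [/\ forall i, f 0 i = 0, forall i, f k i = e i,
      forall j i, k < j -> f j i = 0
    & forall j, j < k -> interlace (f j) (f j.+1)].

Lemma gt_le_top f j i : gt_pattern f -> j <= k -> f j i <= e i.
Proof.
move=> [_ fk _ fI] jk; rewrite -fk -(subKn jk).
elim: (k - j) => [|n IH]; first by rewrite subn0.
case: (ltnP n k) => nk; last first.
  by have -> : k - n.+1 = k - n by lia.
apply: leq_trans IH; have /fI/(_ i) : k - n.+1 < k by lia.
by rewrite subnSK // => /andP[].
Qed.

Lemma gt_col_out f j i : gt_pattern f -> k <= i -> f j i = 0.
Proof.
move=> fG ki; have [_ _ fo _] := fG.
case: (leqP j k) => [jk|]; last exact: fo.
by apply/eqP; rewrite -leqn0 -(e_out ki); exact: gt_le_top.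
Qed.

Lemma gt_tri f j i : gt_pattern f -> j <= i -> f j i = 0.
Proof.
move=> fG; have [f0 fk fo fI] := fG.
elim: j i => [|j IH] i ji; first exact: f0.
case: (ltnP j k) => jk; last exact: fo.
case: i ji => // i ji; have := fI j jk i; rewrite (IH i ji); lia.
Qed.

Lemma gt_leS f j i : gt_pattern f -> j < k -> f j i <= f j.+1 i.
Proof. by move=> [_ _ _ /[apply] fI]; have := fI i; case/andP. Qed.

(** A finite code for patterns: their entries are bounded by those of [e], hence by the sum of
    [e]. *)
Definition pattern : finType := {ffun 'I_k.+1 * 'I_k -> 'I_(psum e k).+1}.

Definition pat_fun (x : pattern) (j i : nat) : nat :=
  if insub j is Some j' then
    if insub i is Some i' then x (j', i') else 0
  else 0.

Definition pat_of (f : nat -> nat -> nat) : pattern :=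
  [ffun p : 'I_k.+1 * 'I_k => inord (f p.1 p.2)].

Lemma pat_funK x : pat_of (pat_fun x) = x.
Proof.
apply/ffunP => -[j i]; rewrite ffunE /pat_fun /= !valK.
by apply: val_inj; rewrite /= inordK.
Qed.

Lemma pat_ofK f : gt_pattern f -> pat_fun (pat_of f) = f.
Proof.
move=> fG; apply/funext => j; apply/funext => i; rewrite /pat_fun.
case: insubP => [j' _ <-|]; last first.
  by rewrite ltnS -ltnNge => kj; have [_ _ ->] := fG.
case: insubP => [i' _ <-|]; last first.
  by rewrite -leqNgt => ki; rewrite (gt_col_out _ fG).
rewrite ffunE /= inordK // ltnS; apply: leq_trans (gt_le_top _ fG _) _.
  by rewrite -ltnS.
by rewrite /psum (bigD1 i') //= leq_addr.
Qed.

(** * Sums over patterns and involutions on them *)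

Local Open Scope ring_scope.

Definition gt_sum (C : zmodType) (P : (nat -> nat -> nat) -> Prop)
    (F : (nat -> nat -> nat) -> C) : C :=
  \sum_(x : pattern | `[< gt_pattern (pat_fun x) /\ P (pat_fun x) >])
     F (pat_fun x).

Lemma eq_gt_sum (C : zmodType) (P Q : (nat -> nat -> nat) -> Prop)
    (F G : (nat -> nat -> nat) -> C) :
  (forall f, gt_pattern f -> P f <-> Q f) ->
  (forall f, gt_pattern f -> P f -> F f = G f) -> gt_sum P F = gt_sum Q G.
Proof.
move=> PQ FG; apply: eq_big => [x|x /asboolP[]]; last exact: FG.
by apply/asboolP/asboolP => -[xG xP]; split => //; apply/PQ.
Qed.

Lemma gt_sum_involution (C : zmodType) (P : (nat -> nat -> nat) -> Prop)
    phi (F : (nat -> nat -> nat) -> C) :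
  (forall f, gt_pattern f -> P f ->
     [/\ gt_pattern (phi f), P (phi f) & phi (phi f) = f]) ->
  gt_sum P F = gt_sum P (F \o phi).
Proof.
move=> phiP; rewrite /gt_sum.
pose h x := pat_of (phi (pat_fun x)).
have hK x : gt_pattern (pat_fun x) -> P (pat_fun x) -> h (h x) = x.
  move=> xG xP; have [G1 P1 E1] := phiP _ xG xP.
  by rewrite /h pat_ofK // E1 pat_funK.
have hP x : gt_pattern (pat_fun x) -> P (pat_fun x) ->
    pat_fun (h x) = phi (pat_fun x).
  by move=> xG xP; have [G1 P1 E1] := phiP _ xG xP; rewrite /h pat_ofK.
rewrite (reindex_onto h h) => [|x /asboolP[]]; last exact: hK.
apply: eq_big => [x|x /andP[/asboolP[xG xP] /eqP E]]; last first.
  have E2 : pat_fun x = phi (pat_fun (h x)) by rewrite -hP // E.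
  by rewrite /= [in RHS]E2; have [_ _ ->] := phiP _ xG xP.
apply/andP/asboolP => [[/asboolP[xG xP] /eqP E]|[xG xP]].
  by rewrite -E hP //; have [] := phiP _ xG xP.
rewrite hK // eqxx; split=> //; apply/asboolP.
by rewrite hP //; have [] := phiP _ xG xP.
Qed.

(** The sum equals its opposite, hence vanishes in characteristic zero. *)
Lemma gt_sum_cancel (C : numDomainType) (P : (nat -> nat -> nat) -> Prop)
    phi (F : (nat -> nat -> nat) -> C) :
  (forall f, gt_pattern f -> P f ->
     [/\ gt_pattern (phi f), P (phi f), phi (phi f) = f & F (phi f) = - F f]) ->
  gt_sum P F = 0.
Proof.
move=> phiP; have E : gt_sum P F = - gt_sum P F.
  rewrite {1}(@gt_sum_involution _ P phi); last by move=> f fG /(phiP f fG)[].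
  rewrite /gt_sum -sumrN; apply: eq_bigr => x /asboolP[xG xP].
  by have [] := phiP _ xG xP.
by apply/eqP; rewrite -eqNr; apply/eqP.
Qed.

Lemma gt_sum_split (C : zmodType) (P : (nat -> nat -> nat) -> Prop)
    (F : (nat -> nat -> nat) -> C) :
  gt_sum (fun=> True) F = gt_sum P F + gt_sum (fun f => ~ P f) F.
Proof.
rewrite /gt_sum (bigID (fun x => `[< P (pat_fun x) >])) /=.
congr (_ + _); apply: eq_bigl => x.
  by apply/andP/asboolP => [[/asboolP[? _] /asboolP]|[? ?]]//; split; apply/asboolP.
apply/andP/asboolP => [[/asboolP[? _] /asboolPn]|[? ?]]//.
by split; [|apply/asboolPn]; rewrite ?asboolE //; apply/asboolP.
Qed.

Local Close Scope ring_scope.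

(** * Changing one level, and the symmetry of the weights *)

Definition set_level (f : nat -> nat -> nat) j (h : nat -> nat) :=
  fun j' i => if j' == j then h i else f j' i.

Lemma set_levelE f j h : set_level f j h j = h.
Proof. by apply/funext => i; rewrite /set_level eqxx. Qed.

Lemma set_level_neq f j h j' : j' <> j -> set_level f j h j' = f j'.
Proof. by move=> /eqP/negbTE E; apply/funext => i; rewrite /set_level E. Qed.

Lemma gt_set_level f j h : gt_pattern f -> j.+1 < k ->
  interlace h (f j.+2) -> interlace (f j) h ->
  gt_pattern (set_level f j.+1 h).
Proof.
move=> [f0 fk fo fI] jk hu hd; split=> [i|i|j' i kj|j' j'k].
- by rewrite set_level_neq.
- by rewrite set_level_neq //; lia.
- by rewrite set_level_neq ?fo//; lia.
have [->|/eqP n1] := eqVneq j' j; first by rewrite set_levelE set_level_neq //; lia.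
have [->|/eqP n2] := eqVneq j' j.+1.
  by rewrite set_levelE set_level_neq //; lia.
by rewrite !set_level_neq //; [exact: fI|lia].
Qed.

Lemma gt_bounds f j : gt_pattern f -> j.+1 < k ->
  forall i, lower (f j.+2) (f j) i <= f j.+1 i <= upper (f j.+2) (f j) i.
Proof.
by move=> [_ _ _ fI] jk; apply: interlace_bounds; apply: fI => //; exact: ltnW.
Qed.

Lemma gt_set_level_bounds f j h : gt_pattern f -> j.+1 < k ->
  (forall i, lower (f j.+2) (f j) i <= h i <= upper (f j.+2) (f j) i) ->
  gt_pattern (set_level f j.+1 h).
Proof.
by move=> fG jk /bounds_interlace[hu hd]; exact: gt_set_level.
Qed.

Definition weight (f : nat -> nat -> nat) (j : nat) : nat :=
  psum (f j.+1) k - psum (f j) k.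

Lemma psum_weight f j : gt_pattern f -> j < k ->
  psum (f j.+1) k = psum (f j) k + weight f j.
Proof.
move=> fG jk; rewrite /weight subnKC //; apply: leq_sum => i _.
exact: gt_leS.
Qed.

Lemma weight_set_level f j h i : gt_pattern f -> j.+1 < k ->
  i <> j -> i <> j.+1 -> weight (set_level f j.+1 h) i = weight f i.
Proof. by move=> fG jk ij ij1; rewrite /weight !set_level_neq //; lia. Qed.

(** Removes the boundary terms when the telescoped sums are taken over all [k] columns. *)
Lemma upper_out f j : gt_pattern f -> upper (f j.+2) (f j) k = 0.
Proof.
move=> fG; have /= := gt_col_out j.+2 fG (leqnn k).
by rewrite /upper; case: k => [|n] -> //; rewrite min0n.
Qed.

Definition flip_level j f :=
  set_level f j.+1 (flip (f j.+2) (f j) (f j.+1)).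

Lemma flip_levelP j f : gt_pattern f -> j.+1 < k ->
  gt_pattern (flip_level j f) /\ flip_level j (flip_level j f) = f.
Proof.
move=> fG jk; have b := gt_bounds fG jk; split.
  by apply: gt_set_level_bounds => //; exact: flip_bounds.
rewrite /flip_level !set_levelE !set_level_neq; try lia.
apply/funext => j'; have [->|/eqP n1] := eqVneq j' j.+1.
  by rewrite set_levelE; apply/funext => i; rewrite flipK.
by rewrite !set_level_neq.
Qed.

(** The totals of level [a.+1] before and after the flip add up to the totals of its two neighbours,
    so the two successive differences are exchanged. *)
Lemma weight_flip_level f (a b : 'I_k) : gt_pattern f -> b = a.+1 :> nat ->
  forall i : 'I_k, weight (flip_level a f) i = weight f (tperm a b i).
Proof.
move=> fG ba i; have ak : a.+1 < k by rewrite -ba.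
have fb := gt_bounds fG ak; have := psum_flip k fb.
rewrite upper_out // (gt_col_out _ fG (leqnn k)).
have := psum_weight fG (ltnW ak); have := psum_weight fG ak.
case: tpermP => [->|->|/eqP na /eqP nb].
- by rewrite ba /weight /flip_level set_levelE set_level_neq //; lia.
- by rewrite ba /weight /flip_level set_levelE set_level_neq //; lia.
- move=> _ _ _; rewrite weight_set_level // => /eqP.
    by rewrite (inj_eq val_inj) (negbTE na).
  by rewrite -ba (inj_eq val_inj) (negbTE nb).
Qed.

Definition weightT f : 'I_k -> nat := fun i => weight f i.

Lemma gt_sum_adj_swap (C : zmodType) (F : ('I_k -> nat) -> C) (a b : 'I_k) :
  b = a.+1 :> nat ->
  gt_sum (fun=> True) (fun f => F (weightT f)) =
  gt_sum (fun=> True) (fun f => F (weightT f \o tperm a b)).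
Proof.
move=> ba; have ak : a.+1 < k by rewrite -ba.
rewrite (@gt_sum_involution _ _ (flip_level a)); last first.
  by move=> f fG _; have [] := flip_levelP fG ak.
apply: eq_gt_sum => // f fG _ /=; congr F; apply/funext => i /=.
exact: weight_flip_level.
Qed.

Lemma gt_sum_tperm (C : zmodType) (F : ('I_k -> nat) -> C) (a b : 'I_k) :
  gt_sum (fun=> True) (fun f => F (weightT f)) =
  gt_sum (fun=> True) (fun f => F (weightT f \o tperm a b)).
Proof.
wlog ab : a b / a <= b.
  by move=> W; case: (leqP a b) => [|/ltnW] /W //; rewrite tpermC.
move: ab; rewrite leq_eqVlt => /orP[/eqP/val_inj <-|].
  by apply: eq_gt_sum => // f _ _; congr F; apply/funext => i /=; rewrite tperm1 perm1.
move En : (b - a.+1) => n; elim: n => [|n IH] in F b En *; move=> ab.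
  by apply: gt_sum_adj_swap; lia.
(* With [c] the neighbour [b.-1], the transposition of [a] and [b] is that of [a] and [c] conjugated
   by the adjacent one of [c] and [b]. *)
have ck : b.-1 < k by rewrite (leq_ltn_trans (leq_pred b)).
pose c : 'I_k := Ordinal ck; have cE : b.-1 = c by [].
have bc : b = c.+1 :> nat by rewrite -cE; lia.
have ca : a < c by rewrite -cE; lia.
have En' : c - a.+1 = n by rewrite -cE; lia.
rewrite (gt_sum_adj_swap F bc).
rewrite (IH (fun u => F (u \o tperm c b)) c En' ca).
rewrite (gt_sum_adj_swap (fun u => F ((u \o tperm a c) \o tperm c b)) bc).
apply: eq_gt_sum => // f _ _; congr F; apply/funext => i /=.
have nac : a != c by apply/eqP => E; rewrite E ltnn in ca.
have nab : a != b by apply/eqP => E; rewrite E ltnn in ab.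
have ncb : c != b by apply/eqP => E; move: bc; rewrite -E; lia.
have <- : tperm (tperm c b a) (tperm c b c) = tperm a b.
  by rewrite tpermL tpermD // eq_sym.
by rewrite -tpermJ conjgE tpermV !permM.
Qed.

Lemma gt_sum_perm (C : zmodType) (F : ('I_k -> nat) -> C) (s : 'S_k) :
  gt_sum (fun=> True) (fun f => F (weightT f)) =
  gt_sum (fun=> True) (fun f => F (weightT f \o s)).
Proof.
have [ts -> _] := prod_tpermP s; elim: ts F => [|t ts IH] F.
  apply: eq_gt_sum => // f _ _; congr F; apply/funext => i /=.
  by rewrite big_nil perm1.
rewrite big_cons (gt_sum_tperm F t.1 t.2) (IH (fun u => F (u \o tperm t.1 t.2))).
by apply: eq_gt_sum => // f _ _; congr F; apply/funext => i /=; rewrite permM.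
Qed.

(** * Cancellation of the patterns that are not dominant *)

Section Dominance.
Variable lam : nat -> nat.
Hypothesis lam_dec : forall j, j.+1 < k -> lam j.+1 <= lam j.

Definition dom_at f j i : bool :=
  dominates (f j.+2) (f j) (lam j) (lam j.+1) (f j.+1) i.

Definition dominant f : Prop := forall j i, j.+1 < k -> dom_at f j i.

(* The order in which violations are searched: least index first, then largest
   level, so that altering indices [>= i] at level [j.+1] cannot change which
   violation is the first one. *)
Definition first_violation f (p : nat * nat) : Prop :=
  let: (i, j) := p in
  [/\ j.+1 < k, ~~ dom_at f j i,
      forall j' i', j'.+1 < k -> i' < i -> dom_at f j' i'
    & forall j', j < j' -> j'.+1 < k -> dom_at f j' i].

Lemma first_violation_exists f :
  ~ dominant f -> exists p, first_violation f p.
Proof.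
move=> /existsNP[j0 /existsNP[i0 /not_implyP[jk0 /negP nd0]]].
pose P i := `[< exists j, j.+1 < k /\ ~~ dom_at f j i >].
have exP : exists i, P i by exists i0; apply/asboolP; exists j0.
case: (ex_minnP exP) => i /asboolP[j1 [jk1 nd1]] min_i.
pose Q j := (j.+1 < k) && ~~ dom_at f j i.
have exQ : exists j, Q j by exists j1; rewrite /Q jk1.
have ubQ j : Q j -> j <= k by case/andP; lia.
case: (ex_maxnP exQ ubQ) => j /andP[jk nd] max_j.
exists (i, j); split => // [j' i' j'k ii'|j' jj' j'k].
  apply/negPn/negP => nd'; have : P i' by apply/asboolP; exists j'.
  by move/min_i; lia.
apply/negPn/negP => nd'; have : Q j' by rewrite /Q j'k.
by move/max_j; lia.
Qed.

Lemma first_violation_unique f p q :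
  first_violation f p -> first_violation f q -> p = q.
Proof.
case: p q => [i j] [i' j'] [jk nd m1 m2] [jk' nd' m1' m2'].
case: (ltngtP i i') => [ii|ii|ii].
- by move: nd; rewrite m1'.
- by move: nd'; rewrite m1.
subst i'; congr pair; case: (ltngtP j j') => // jj.
- by move: nd'; rewrite m2.
- by move: nd; rewrite m2'.
Qed.

Definition reflect_at (p : nat * nat) f :=
  let: (i, j) := p in
  set_level f j.+1
    (reflect_from (f j.+2) (f j) (lam j) (lam j.+1) i (f j.+1)).

Definition reflect_first f := reflect_at (xget (0, 0) (first_violation f)) f.

Lemma reflect_firstE f p : first_violation f p ->
  reflect_first f = reflect_at p f.
Proof.
move=> fp; rewrite /reflect_first; congr reflect_at; case: xgetP => [q _ fq|].
  exact: first_violation_unique fq fp.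
by move=> /(_ p).
Qed.

Section At.
Variables (f : nat -> nat -> nat) (i j : nat).
Hypotheses (fG : gt_pattern f) (fv : first_violation f (i, j)).

Let jk : j.+1 < k. Proof. by case: fv. Qed.
Let nd : ~~ dom_at f j i. Proof. by case: fv. Qed.
Let dm i' : i' < i -> dom_at f j i'.
Proof. by case: fv => _ _ h _ /h; apply. Qed.
Let bnd := gt_bounds fG jk.

Let h := reflect_from (f j.+2) (f j) (lam j) (lam j.+1) i (f j.+1).

Lemma reflect_at_gt : gt_pattern (reflect_at (i, j) f).
Proof.
apply: gt_set_level_bounds => //.
exact: (reflect_from_bounds (lam_dec jk) bnd dm nd).
Qed.

Lemma reflect_at_level j' : j' <> j.+1 -> reflect_at (i, j) f j' = f j'.
Proof. exact: set_level_neq. Qed.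

Lemma reflect_at_levelE : reflect_at (i, j) f j.+1 = h.
Proof. exact: set_levelE. Qed.

Lemma reflect_at_lt j' i' : i' < i -> reflect_at (i, j) f j' i' = f j' i'.
Proof.
move=> ii; have [->|/eqP n] := eqVneq j' j.+1; last by rewrite reflect_at_level.
by rewrite reflect_at_levelE /h /reflect_from ii.
Qed.

Lemma reflect_at_violation : first_violation (reflect_at (i, j) f) (i, j).
Proof.
have [_ _ m1 m2] := fv; split => //.
- rewrite /dom_at reflect_at_levelE !reflect_at_level; try lia.
  exact: (reflect_ndominates (lam_dec jk) bnd dm nd).
- move=> j' i' j'k ii; have := m1 j' i' j'k ii; rewrite /dom_at /dominates.
  have E j1 n : n <= i -> psum (reflect_at (i, j) f j1) n = psum (f j1) n.
    by move=> ni; apply: eq_psum => i1 lt; rewrite reflect_at_lt //; lia.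
  by rewrite !E //; lia.
- move=> j' jj j'k; have := m2 j' jj j'k; rewrite /dom_at.
  rewrite !(@reflect_at_level j'.+1) ?(@reflect_at_level j'.+2); try lia.
  (* For [j' = j.+1] the altered level plays the part of [dn], whose partial sum stops before index
     [i]. *)
  have [E|/eqP n] := eqVneq j' j.+1; last by rewrite (reflect_at_level n).
  rewrite E reflect_at_levelE /dominates.
  by rewrite psum_reflect_lt.
Qed.

Lemma reflect_atK : reflect_at (i, j) (reflect_at (i, j) f) = f.
Proof.
apply/funext => j'; have [->|/eqP n] := eqVneq j' j.+1; last first.
  by rewrite [LHS]set_level_neq // reflect_at_level.
rewrite [LHS]set_levelE reflect_at_levelE !reflect_at_level; try lia.
by apply/funext => i'; rewrite (reflectK (lam_dec jk) bnd dm nd).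
Qed.

Lemma weight_reflect_at (a b : 'I_k) : a = j :> nat -> b = j.+1 :> nat ->
  forall i' : 'I_k,
  lam i' + weight (reflect_at (i, j) f) i' + (k - i'.+1) =
  lam (tperm a b i') + weight f (tperm a b i') + (k - (tperm a b i').+1).
Proof.
move=> aj bj i'.
(* A violation at [i] forces a positive entry [i] on the level above, while columns from [k] on are
   zero. *)
have ik : i < k.
  rewrite ltnNge; apply/negP => ki.
  have [] := reflect_from_fact (lam_dec jk) bnd dm nd.
  by move=> _; rewrite (gt_col_out j.+2 fG ki) ltn0.
have := psum_reflect (lam_dec jk) bnd dm nd ik.
rewrite upper_out // (gt_col_out _ fG (leqnn k)).
have := psum_weight fG (ltnW jk); have := psum_weight fG jk.
have := psum_weight reflect_at_gt (ltnW jk).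
have := psum_weight reflect_at_gt jk.
rewrite reflect_at_levelE !reflect_at_level; try lia.
rewrite -/h; case: tpermP => [->|->|/eqP na /eqP nb].
- rewrite aj bj; lia.
- rewrite aj bj; lia.
- move=> _ _ _ _ _; rewrite weight_set_level // => /eqP.
    by rewrite -aj (inj_eq val_inj) (negbTE na).
  by rewrite -bj (inj_eq val_inj) (negbTE nb).
Qed.

End At.

Definition shifted_weight f : 'I_k -> nat :=
  fun i => lam i + weight f i + (k - i.+1).

Theorem gt_sum_dominant (C : numDomainType) (F : ('I_k -> nat) -> C) :
  (forall u (a b : 'I_k), a != b -> F (u \o tperm a b) = - F u)%R ->
  gt_sum (fun=> True) (fun f => F (shifted_weight f)) =
  gt_sum dominant (fun f => F (shifted_weight f)).
Proof.
move=> F_alt; rewrite (gt_sum_split dominant) [X in (_ + X)%R](_ : _ = 0%R) ?addr0//.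
apply: (@gt_sum_cancel _ _ reflect_first) => f fG /first_violation_exists[[i j] fv].
have fv' := reflect_at_violation fG fv.
rewrite (reflect_firstE fv) (reflect_firstE fv') reflect_atK //.
split=> //; first exact: reflect_at_gt.
  by move=> D; have [jk /negP nd _ _] := fv'; apply/nd/D.
have [jk _ _ _] := fv.
rewrite -(F_alt _ (Ordinal (ltnW jk)) (Ordinal jk)); last first.
  by rewrite -(inj_eq val_inj) /= ltn_eqF.
by congr F; apply/funext => i'; exact: weight_reflect_at.
Qed.

End Dominance.

(** With [lam = 0], dominance bounds the partial sums of level [j.+1] up to index [i <= j] by those
    of level [j], by induction on [i]. The reverse bound always holds, so entry [i] is frozen from
    level [i.+1] on and equals [e i]. *)
Lemma dominant0_unique f : gt_pattern f -> dominant (fun=> 0) f ->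
  forall j i, j <= k -> f j i = if i < j then e i else 0.
Proof.
move=> fG fD; have [f0 fk fo fI] := fG.
have tri j i : j <= i -> f j i = 0 by exact: gt_tri.
have le_psum j n : j < k -> psum (f j) n <= psum (f j.+1) n.
  by move=> jk; apply: leq_sum => i _; exact: gt_leS.
have eq_sum i : forall j, i <= j -> j < k -> psum (f j.+1) i = psum (f j) i.
  elim: i => [|i IH] j ij jk; first by rewrite !psum0.
  case: j ij jk => // j ij jk.
  have := fD j i jk; have := le_psum j.+1 i.+1 jk; have := IH j ij (ltnW jk).
  rewrite /dom_at /dominates; lia.
have step i j : i < j -> j < k -> f j.+1 i = f j i.
  move=> ij jk; have := eq_sum i.+1 j ij jk; have := eq_sum i j (ltnW ij) jk.
  by rewrite !psumS; lia.
move=> j i jk; case: ltnP => ij; last exact: tri.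
have up n : j <= n -> n <= k -> f n i = f j i.
  elim: n => [|n IH]; first by rewrite leqn0 => /eqP ->.
  rewrite leq_eqVlt => /orP[/eqP <- //|jn nk].
  by rewrite step ?IH //; lia.
by rewrite -(up k).
Qed.

End GelfandTsetlin.

(** * The bialternant formula *)

Section Determinant.
Variables (k : nat) (e : nat -> nat).
Hypothesis e_out : forall i, k <= i -> e i = 0.
Hypothesis e_dec : forall i, e i.+1 <= e i.

(** The highest weight pattern: in tableau terms every entry [i] lies in row [i]. *)
Definition top_pattern : nat -> nat -> nat :=
  fun j i => if (j <= k) && (i < j) then e i else 0.

Lemma top_pattern_gt : gt_pattern k e top_pattern.
Proof.
split=> [i|i|j i kj|j jk i]; rewrite /top_pattern.
- by rewrite ltn0 andbF.
- by rewrite leqnn /=; case: ltnP => // /e_out.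
- by rewrite leqNgt kj.
rewrite jk (ltnW jk) /= ltnS; have := e_dec i.
by case: (ltngtP i j) => [ij|ij|->]; repeat case: ifP; lia.
Qed.

Lemma psum_top_pattern j n : j <= k ->
  psum (top_pattern j) n = psum e (minn n j).
Proof.
move=> jk; elim: n => [|n IH]; first by rewrite min0n !psum0.
rewrite psumS IH /top_pattern jk /=; case: ltnP => nj.
  by rewrite (minn_idPl nj) psumS.
by rewrite addn0 (minn_idPr (leqW nj)).
Qed.

Lemma weight_top_pattern j : j < k -> weight k top_pattern j = e j.
Proof.
move=> jk; rewrite /weight !psum_top_pattern ?(ltnW jk) //.
by rewrite (minn_idPr jk) (minn_idPr (ltnW jk)) psumS addKn.
Qed.

Lemma top_pattern_dominant (lam : nat -> nat) :
  (forall j, j.+1 < k -> lam j.+1 <= lam j) -> dominant k lam top_pattern.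
Proof.
move=> lam_dec j i jk; rewrite /dom_at /dominates !psum_top_pattern; try lia.
have := lam_dec j jk; have := e_dec j; case: (ltngtP i j) => [ij|ji|->].
- rewrite (_ : minn i.+1 j.+2 = i.+1); last by lia.
  rewrite (_ : minn i j.+1 = i); last by lia.
  by rewrite (_ : minn i.+1 j.+1 = i.+1); lia.
- rewrite (_ : minn i.+1 j.+2 = j.+2); last by lia.
  rewrite (_ : minn i j.+1 = j.+1); last by lia.
  by rewrite (_ : minn i.+1 j.+1 = j.+1) ?psumS; lia.
- rewrite (_ : minn j.+1 j.+2 = j.+1); last by lia.
  rewrite (_ : minn j j.+1 = j); last by lia.
  by rewrite (_ : minn j.+1 j.+1 = j.+1); lia.
Qed.

Local Open Scope ring_scope.

Lemma gt_sum_unique (C : zmodType) (P : (nat -> nat -> nat) -> Prop)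
    (F : (nat -> nat -> nat) -> C) f0 :
  gt_pattern k e f0 -> P f0 ->
  (forall f, gt_pattern k e f -> P f -> f = f0) -> gt_sum k e P F = F f0.
Proof.
move=> G0 P0 U; rewrite /gt_sum (big_pred1 (pat_of k e f0)).
  by rewrite (pat_ofK e_out G0).
move=> x; apply/asboolP/eqP => [[xG xP]|->].
  by rewrite -(U _ xG xP) pat_funK.
by rewrite (pat_ofK e_out G0).
Qed.

Lemma det_rev_alt (C : comNzRingType) (h : 'I_k -> nat -> C) u (a b : 'I_k) :
  a != b ->
  \det (\matrix_(l, j) h l ((u \o tperm a b) (rev_ord j))) =
  - \det (\matrix_(l, j) h l (u (rev_ord j))).
Proof.
move=> ab; pose M := \matrix_(l, j) h l (u (rev_ord j)).
have E : \matrix_(l, j) h l ((u \o tperm a b) (rev_ord j)) =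
    xcol (rev_ord a) (rev_ord b) M.
  apply/matrixP => l j; rewrite !mxE /=; congr (h l (u _)).
  by rewrite (inj_tperm _ _ _ (@rev_ord_inj k)) !rev_ordK.
rewrite E xcolE det_mulmx det_perm odd_tperm (inj_eq rev_ord_inj) ab expr1.
by rewrite mulrN1.
Qed.

(** Cancellation with [lam = 0] leaves only [top_pattern], whose shifted weight yields the left-hand
    side. *)
Lemma bialternant (C : numDomainType) (h : 'I_k -> nat -> C) :
  \det (\matrix_(l, j) h l (e (rev_ord j) + j)%N) =
  gt_sum k e (fun=> True)
    (fun f => \det (\matrix_(l, j) h l (weight k f (rev_ord j) + j)%N)).
Proof.
pose F u := \det (\matrix_(l, j) h l (u (rev_ord j))).
have D0 j : (j.+1 < k)%N -> (0 <= 0)%N by [].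
have EF u : F (fun i : 'I_k => u i + (k - i.+1))%N =
    \det (\matrix_(l, j) h l (u (rev_ord j) + j)%N).
  congr (\det _); apply/matrixP => l j; rewrite !mxE; congr (h l (_ + _)%N).
  by rewrite /=; have := ltn_ord j; lia.
transitivity (gt_sum k e (dominant k (fun=> 0%N))
    (fun f => F (shifted_weight (k:=k) (fun=> 0%N) f))); last first.
  rewrite -(gt_sum_dominant e_out D0); last by move=> u a b; exact: det_rev_alt.
  apply: eq_gt_sum => // f fG _.
  rewrite -(EF (fun i => weight k f i)).
  by congr F; apply/funext => i; rewrite /shifted_weight add0n.
rewrite (@gt_sum_unique _ _ _ top_pattern).
- rewrite -(EF (fun i => e i)); congr F; apply/funext => i.
  by rewrite /shifted_weight add0n weight_top_pattern.
- exact: top_pattern_gt.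
- exact: top_pattern_dominant.
move=> f fG fD; apply/funext => j; apply/funext => i; rewrite /top_pattern.
case: (leqP j k) => [jk|kj]; last by case: fG => _ _ fo _; exact: fo.
by rewrite (dominant0_unique fG fD).
Qed.

(* Exchanging the two index roles is the symmetry of the Schur polynomial. *)
Lemma bialternant_tr (C : numDomainType) (h : 'I_k -> nat -> C) :
  \det (\matrix_(l, j) h l (e (rev_ord j) + j)%N) =
  gt_sum k e (fun=> True)
    (fun f => \det (\matrix_(l, j) h j (weight k f (rev_ord j) + l)%N)).
Proof.
rewrite bialternant.
pose T (s : 'S_k) (u : 'I_k -> nat) : C :=
  (-1) ^+ s * \prod_j h (s j) (u (rev_ord j) + j)%N.
transitivity (\sum_s gt_sum k e (fun=> True) (fun f => T s (@weightT k f))).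
  rewrite /gt_sum [RHS]exchange_big /=; apply: eq_bigr => x _.
  rewrite -det_tr; apply: eq_bigr => s _; congr (_ * _).
  by apply: eq_bigr => j _; rewrite !mxE.
(* Column [j] reads the weight at [rev_ord j]; permuting the weights by the conjugate of [s] makes
   it read at [rev_ord (s j)], in step with the factor [h (s j)]. *)
pose rv : 'S_k := perm (@rev_ord_inj k).
transitivity (\sum_s gt_sum k e (fun=> True)
    (fun f => T s (@weightT k f \o (rv * s * rv)%g))).
  by apply: eq_bigr => s _; exact: gt_sum_perm.
rewrite /gt_sum [LHS]exchange_big /=; apply: eq_bigr => x _.
apply: eq_bigr => s _; congr (_ * _); apply: eq_bigr => j _.
by rewrite !mxE /weightT /= !permM !permE rev_ordK.
Qed.

End Determinant.

(** * Littlewood-Richardson tableaux as dominant patterns *)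

Lemma card_split (T : finType) (P P1 P2 : pred T) :
  (forall c, P c = P1 c || P2 c) -> (forall c, ~~ (P1 c && P2 c)) ->
  #|[pred c | P c]| = #|[pred c | P1 c]| + #|[pred c | P2 c]|.
Proof.
move=> PE dis; rewrite -!sum1_card [LHS]big_mkcond [X in X + _]big_mkcond.
rewrite [X in _ + X]big_mkcond -big_split /=.
apply: eq_bigr => c _; rewrite !inE PE; have := dis c.
by case: (P1 c); case: (P2 c).
Qed.

Lemma sub_card (T : finType) (P Q : pred T) : (forall c, P c -> Q c) ->
  #|[pred c | P c]| <= #|[pred c | Q c]|.
Proof. by move=> PQ; apply/subset_leq_card/fintype.subsetP => c; exact: PQ. Qed.

Lemma psum_card (T : finType) (Q : pred T) (t : T -> nat) n :
  psum (fun i => #|[pred c | Q c & t c == i]|) n = #|[pred c | Q c & t c < n]|.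
Proof.
elim: n => [|n IH].
  by rewrite psum0; apply/esym/eq_card0 => c; rewrite !inE ltn0 andbF.
rewrite psumS IH; apply/esym/card_split => c.
  by rewrite ltnS leq_eqVlt orbC andb_orr.
by case: (Q c) => //=; case: ltngtP.
Qed.

(** Makes a down-closed set of cells a prefix of the reading word, so that the lattice condition can
    be tested on it. *)
Lemma filter_take_sorted (T : eqType) (r : rel T) (P : pred T) (s : seq T) :
  transitive r -> sorted r s -> (forall c d, r c d -> P d -> P c) ->
  filter P s = take (count P s) s.
Proof.
move=> tr + dc; elim: s => //= c s IH ss.
case Pc: (P c) => /=; first by rewrite IH // (path_sorted ss).
have /allP all_c := order_path_min tr ss.
have c0 : count P s = 0.
  apply/eqP; rewrite -leqn0 leqNgt -has_count; apply/hasPn => d /all_c cd.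
  by apply/negP => /(dc _ _ cd); rewrite Pc.
by rewrite c0; apply/eqP; rewrite -size_eq0 size_filter c0.
Qed.

Section Tableaux.
Variables (k : nat) (gam lam : k.-tuple nat).

Notation cell := (skew_cell gam lam).
Notation L := (nth 0 lam).
Notation G := (nth 0 gam).

Definition row (c : cell) : nat := (val c).1.
Definition col (c : cell) : nat := (val c).2.

Lemma row_lt c : row c < k. Proof. exact: ltn_ord. Qed.

Lemma cell_cond c : L (row c) <= col c < G (row c).
Proof. by have := valP c; rewrite !(tnth_nth 0). Qed.

Lemma cell_ex j c : j < k -> L j <= c < G j ->
  exists d : cell, row d = j /\ col d = c.
Proof.
move=> jk jc; have cm : c < \max_(i < k) tnth gam i.
  apply: leq_trans (leq_bigmax (Ordinal jk)).
  by rewrite (tnth_nth 0) /=; case/andP: jc.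
have P : (tnth lam (Ordinal jk) <= Ordinal cm < tnth gam (Ordinal jk))%N.
  by rewrite !(tnth_nth 0).
by exists (exist _ (Ordinal jk, Ordinal cm) P).
Qed.

Lemma cell_inj c d : row c = row d -> col c = col d -> c = d.
Proof.
move=> rE cE; apply: val_inj; rewrite [LHS]surjective_pairing.
by rewrite [RHS]surjective_pairing; congr pair; exact: val_inj.
Qed.

Lemma card_row_interval j a b : j < k -> L j <= a -> b <= G j ->
  #|[pred d : cell | row d == j & a <= col d < b]| = b - a.
Proof.
move=> jk La bG; rewrite cardE -(size_map col) -[RHS](size_iota a).
apply: perm_size; apply: uniq_perm.
- rewrite map_inj_in_uniq ?enum_uniq // => c d.
  rewrite !mem_enum !inE => /andP[/eqP rc _] /andP[/eqP rd _].
  by apply: cell_inj; rewrite rc rd.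
- exact: iota_uniq.
move=> c; rewrite mem_iota; apply/mapP/idP => [[d]|ac].
  by rewrite mem_enum inE => /andP[_ ?] ->; lia.
have [|d [rd cd]] := @cell_ex j c jk; first by lia.
by exists d => //; rewrite mem_enum inE rd eqxx cd; lia.
Qed.

Hypothesis L_dec : forall j, j.+1 < k -> L j.+1 <= L j.
Hypothesis G_dec : forall j, j.+1 < k -> G j.+1 <= G j.
Hypothesis LG : forall j, L j <= G j.

Implicit Types T : filling gam lam.

(** * From tableaux to patterns *)

Definition row_count T j i := #|[pred c | row c == j & (T c : nat) == i]|.

Definition tab_pattern T (j i : nat) : nat :=
  if j <= k then #|[pred c | row c < j & (T c : nat) == i]| else 0.

Lemma tab_patternS T j i : j < k ->
  tab_pattern T j.+1 i = tab_pattern T j i + row_count T j i.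
Proof.
move=> jk; rewrite /tab_pattern jk (ltnW jk); apply: card_split => c.
  by rewrite ltnS leq_eqVlt orbC andb_orl.
by case: (ltngtP (row c) j); rewrite ?andbF.
Qed.

Lemma psum_tab_patternS T j n : j < k ->
  psum (tab_pattern T j.+1) n = psum (tab_pattern T j) n + psum (row_count T j) n.
Proof.
move=> jk; elim: n => [|n IH]; first by rewrite !psum0.
by rewrite !psumS IH tab_patternS //; lia.
Qed.

Lemma psum_row_count T j n :
  psum (row_count T j) n = #|[pred c | row c == j & T c < n]|.
Proof. exact: psum_card. Qed.

Lemma row_total T j : j < k -> L j + psum (row_count T j) k = G j.
Proof.
move=> jk; rewrite psum_row_count.
have -> : #|[pred c | row c == j & T c < k]| = G j - L j.
  rewrite -(card_row_interval jk (leqnn _) (leqnn _)); apply: eq_card => c.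
  rewrite !inE ltn_ord; case: eqP => //= rc.
  by have := cell_cond c; rewrite rc => ->.
by rewrite subnKC.
Qed.

Lemma semistandard_row T c d : semistandard T -> row c = row d ->
  col c <= col d -> T c <= T d.
Proof.
move=> /forallP/(_ c)/forallP/(_ d)/andP[/implyP h _] rE cE; apply: h.
by rewrite cE andbT; apply/eqP/val_inj.
Qed.

Lemma semistandard_col T c d : semistandard T -> col c = col d ->
  row c < row d -> T c < T d.
Proof.
move=> /forallP/(_ c)/forallP/(_ d)/andP[_ /implyP h] cE rE; apply: h.
by rewrite rE andbT; apply/eqP/val_inj.
Qed.

Lemma semistandardP T :
  (forall c d, row c = row d -> col c <= col d -> T c <= T d) ->
  (forall c d, col c = col d -> row c < row d -> T c < T d) ->
  semistandard T.
Proof.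
move=> h1 h2; apply/forallP => c; apply/forallP => d.
apply/andP; split; apply/implyP => /andP[/eqP E] h; [apply: h1|apply: h2] => //.
  by rewrite /row E.
by rewrite /col E.
Qed.

(* The entries [< i] of a row occupy an initial segment of it. *)
Lemma entry_ltE T c i : semistandard T ->
  (T c < i) = (col c < L (row c) + psum (row_count T (row c)) i).
Proof.
move=> ssT; rewrite psum_row_count; have := cell_cond c => cc.
case: (ltnP (T c) i) => Tc; apply/esym.
  suff : (col c).+1 - L (row c) <= #|[pred d | row d == row c & T d < i]| by lia.
  rewrite -(@card_row_interval (row c)) ?row_lt ?leqnn //; last by lia.
  apply: sub_card => d /andP[/eqP rd cd]; rewrite rd eqxx /=.
  by apply: leq_ltn_trans Tc; apply: semistandard_row => //; lia.
apply/negbTE; rewrite -leqNgt.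
suff : #|[pred d | row d == row c & T d < i]| <= col c - L (row c) by lia.
rewrite -(@card_row_interval (row c)) ?row_lt ?leqnn //; last by lia.
apply: sub_card => d /andP[/eqP rd Td]; rewrite rd eqxx /=.
have := cell_cond d; rewrite rd => /andP[-> _] /=; rewrite ltnNge; apply/negP => le.
by have := semistandard_row ssT (esym rd) le; lia.
Qed.

(** Otherwise the column [y] just after the entries [< i] of row [j] has an entry [>= i] in row [j]
    and one [<= i] in row [j.+1], against column strictness. *)
Lemma tab_pattern_dominant T : semistandard T ->
  dominant k L (tab_pattern T).
Proof.
move=> ssT j i jk; rewrite /dom_at /dominates.
rewrite !psum_tab_patternS ?(ltnW jk) //.
suff : L j.+1 + psum (row_count T j.+1) i.+1 <= L j + psum (row_count T j) i by lia.
rewrite leqNgt; apply/negP => lt.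
set y := L j + _ in lt.
have le1 : L j.+1 + psum (row_count T j.+1) i.+1 <= G j.+1.
  rewrite -(row_total T jk) leq_add2l !psum_row_count; apply: sub_card => c.
  by case/andP => -> _ /=.
have yL : L j <= y by exact: leq_addr.
have := L_dec jk; have := G_dec jk => Gd Ld.
have [|c [rc cc]] := @cell_ex j y (ltnW jk); first by lia.
have [|d [rd cd]] := @cell_ex j.+1 y jk; first by lia.
have := entry_ltE c i ssT; have := entry_ltE d i.+1 ssT.
rewrite rc rd cc cd lt ltnn.
have : T c < T d by apply: semistandard_col; rewrite ?rc ?rd ?cc ?cd.
lia.
Qed.


Lemma reading_leq_trans : transitive (@reading_leq k gam lam).
Proof.
move=> d c c'; rewrite /reading_leq -!(inj_eq val_inj) /=; lia.
Qed.

Lemma reading_leq_total : total (@reading_leq k gam lam).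
Proof. by move=> c d; rewrite /reading_leq -!(inj_eq val_inj) /=; lia. Qed.

Lemma reading_leqP (c d : cell) : reading_leq c d ->
  row c < row d \/ row c = row d /\ col d <= col c.
Proof.
rewrite /reading_leq -(inj_eq val_inj) => /orP[?|/andP[/eqP ? ?]]; [left|right] => //.
Qed.

Definition cells : seq cell := sort (@reading_leq k gam lam) (enum cell).

Lemma cells_sorted : sorted (@reading_leq k gam lam) cells.
Proof. exact: sort_sorted reading_leq_total _. Qed.

Lemma count_cells (P : pred cell) : count P cells = #|[pred c | P c]|.
Proof.
have /seq.permP -> : perm_eq cells (enum cell) by rewrite perm_sort.
rewrite enumT cardE /enum_mem size_filter.
by apply: eq_count => c; rewrite inE.
Qed.

Lemma lattice_wordP T :
  lattice_word k (reading_word T) <->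
  forall n a, n <= size cells -> a < k ->
    count (fun c => (T c : nat) == a.+1) (take n cells) <=
    count (fun c => (T c : nat) == a) (take n cells).
Proof.
have E n a : count_mem a (take n (reading_word T)) =
    count (fun c => (T c : nat) == a) (take n cells).
  by rewrite /reading_word -map_take count_map.
rewrite /lattice_word; have -> : size (reading_word T) = size cells by rewrite size_map.
split=> [/allP h n a ns ak|h].
  have /h/allP/(_ a) : n \in iota 0 (size cells).+1 by rewrite mem_iota.
  by rewrite mem_iota !E; apply.
apply/allP => n; rewrite mem_iota => /= ns; apply/allP => a.
by rewrite mem_iota !E => /= ak; exact: h.
Qed.

(** The lattice condition is tested on the prefix formed by the rows before [j] and the entries
    [> i] of row [j], which are read first. It contains every [i.+1] of the first [j.+1] rows, but
    the [i] of the first [j] rows only. *)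
Lemma lattice_interlace T j i : semistandard T ->
  lattice_word k (reading_word T) -> j < k ->
  tab_pattern T j.+1 i.+1 <= tab_pattern T j i.
Proof.
move=> ssT /lattice_wordP lat jk.
case: (ltnP i k) => ik; last first.
  rewrite [leqLHS](_ : _ = 0) // /tab_pattern jk; apply: eq_card0 => c.
  by rewrite !inE; apply/negbTE/nandP; right; have := ltn_ord (T c); lia.
pose P (c : cell) := (row c < j) || ((row c == j) && (i < T c)).
have dc c d : reading_leq c d -> P d -> P c.
  move=> /reading_leqP[rr|[rr cc]]; rewrite /P; first lia.
  by have := semistandard_row ssT (esym rr) cc; rewrite rr; lia.
have := lat (count P cells) i (count_size _ _) ik.
rewrite -(filter_take_sorted reading_leq_trans cells_sorted dc) !count_filter.
rewrite !count_cells => le.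
have -> : tab_pattern T j.+1 i.+1 =
    #|[pred c | predI (fun c => (T c : nat) == i.+1) P c]|.
  rewrite /tab_pattern jk; apply: eq_card => c; rewrite !inE /P /=; lia.
have -> // : tab_pattern T j i =
    #|[pred c | predI (fun c => (T c : nat) == i) P c]|.
rewrite /tab_pattern (ltnW jk); apply: eq_card => c; rewrite !inE /P /=; lia.
Qed.

(** If the letter following the prefix lies in row [j], the prefix contains all rows before [j] and
    nothing after row [j]; one interlacing inequality between levels [j] and [j.+1] then compares
    the counts. The full word uses the last row. *)
Lemma interlace_lattice T :
  (forall j, j < k -> interlace (tab_pattern T j) (tab_pattern T j.+1)) ->
  lattice_word k (reading_word T).
Proof.
move=> itl; apply/lattice_wordP => n a; rewrite leq_eqVlt => /orP[/eqP ->|ns] ak.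
  rewrite take_size !count_cells.
  have E b : #|[pred c | (T c : nat) == b]| = tab_pattern T k b.
    by rewrite /tab_pattern leqnn; apply: eq_card => c; rewrite !inE row_lt.
  have k1 : k.-1 < k by rewrite prednK // (leq_ltn_trans _ ak).
  have := itl k.-1 k1 a; rewrite prednK -?E; last by rewrite (leq_ltn_trans _ ak).
  by case/andP => /leq_trans; apply.
have [d0 _] : exists d : cell, True by case: cells ns => // d; exists d.
pose d := nth d0 cells n; pose j := row d; have jk : j < k by exact: row_lt.
have := cells_sorted; rewrite (sorted_pairwise reading_leq_trans).
rewrite -{1}(cat_take_drop n cells) (drop_nth d0) // -/d pairwise_cat.
case/and3P => /allrelP lt_take _ /= /andP[/allP le_drop _].
have rt c : c \in take n cells -> row c <= j.
  move=> ct; have := lt_take c d ct; rewrite inE eqxx => /(_ isT).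
  by case/reading_leqP => [/ltnW//|[->]].
have rd c : c \in drop n.+1 cells -> j <= row c.
  by move=> /le_drop/reading_leqP; rewrite -/j; lia.
have /andP[le _] := itl j jk a.
apply: leq_trans (leq_trans le _).
  rewrite /tab_pattern jk -count_cells -[cells in leqRHS](cat_take_drop n).
  rewrite count_cat; apply: leq_trans (leq_addr _ _).
  rewrite [leqLHS](eq_in_count (a2 := fun c => (row c < j.+1) && ((T c : nat) == a.+1))) //.
  by move=> c /rt; rewrite ltnS => ->.
rewrite /tab_pattern (ltnW jk) -count_cells -[cells in leqLHS](cat_take_drop n).
rewrite count_cat [X in _ + X](_ : _ = 0) ?addn0.
  by apply: sub_count => c /andP[].
rewrite (drop_nth d0) //= -/d ltnn /=; apply/eqP; rewrite -leqn0 leqNgt -has_count.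
by apply/hasPn => c /rd jc; rewrite ltnNge jc.
Qed.

Definition boundary (f : nat -> nat -> nat) (i j : nat) : nat :=
  L j + (psum (f j.+1) i - psum (f j) i).

(** Here [boundary f i j] is the column where the entries [< i] of row [j] should end, and a cell
    takes the least entry whose segment reaches past it. The [insubd] default just inhabits ['I_k];
    it is not reached once the weights fill each row up to [G]. *)
Definition fill (f : nat -> nat -> nat) : filling gam lam :=
  [ffun c : cell => insubd (val c).1
     (find (fun i => col c < boundary f i.+1 (row c)) (iota 0 k))].

Lemma boundary_tab_pattern T i j : j < k ->
  boundary (tab_pattern T) i j = L j + psum (row_count T j) i.
Proof. by move=> jk; rewrite /boundary psum_tab_patternS // addKn. Qed.

Section Fill.
Variables (e : nat -> nat) (f : nat -> nat -> nat).
Hypothesis e_out : forall i, k <= i -> e i = 0.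
Hypothesis fG : gt_pattern k e f.
Hypothesis fD : dominant k L f.
Hypothesis fW : forall j, j < k -> L j + weight k f j = G j.

Lemma boundary0 j : boundary f 0 j = L j.
Proof. by rewrite /boundary !psum0 addn0. Qed.

Lemma boundaryk j : j < k -> boundary f k j = G j.
Proof. exact: fW. Qed.

Lemma boundaryS j i : j < k ->
  boundary f i.+1 j + f j i = boundary f i j + f j.+1 i.
Proof.
move=> jk; have le n : psum (f j) n <= psum (f j.+1) n.
  by apply: leq_sum => m _; exact: gt_leS fG jk.
have := le i; have := le i.+1; rewrite /boundary !psumS; lia.
Qed.

Lemma boundary_mono j i i' : j < k -> i <= i' ->
  boundary f i j <= boundary f i' j.
Proof.
move=> jk; elim: i' => [|i' IH]; first by rewrite leqn0 => /eqP ->.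
rewrite leq_eqVlt => /orP[/eqP -> //|/IH].
have := boundaryS i' jk; have := gt_leS i' fG jk; lia.
Qed.

Lemma fill_ltE (c : cell) i : i <= k ->
  (fill f c < i) = (col c < boundary f i (row c)).
Proof.
move=> ik; rewrite ffunE; set p := fun n => col c < _.
have rk := row_lt c; have cc := cell_cond c.
have hp : has p (iota 0 k).
  apply/hasP; exists k.-1; first by rewrite mem_iota; lia.
  by rewrite /p prednK ?boundaryk; lia.
have fk : find p (iota 0 k) < k by rewrite -{2}(size_iota 0 k) -has_find.
rewrite val_insubd /= fk; apply/idP/idP => [lt|].
  have := nth_find 0 hp; rewrite nth_iota // add0n => h.
  exact: leq_trans h (boundary_mono rk lt).
case: i ik => [|i] ik; first by rewrite boundary0; lia.
move=> lt; rewrite ltnS leqNgt; apply/negP => /(before_find 0).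
by rewrite nth_iota // add0n /p lt.
Qed.

Lemma row_count_fill j i : j < k -> row_count (fill f) j i = f j.+1 i - f j i.
Proof.
move=> jk; case: (ltnP i k) => ik; last first.
  rewrite (gt_col_out e_out _ fG ik) sub0n; apply: eq_card0 => c.
  rewrite !inE; apply/negP => /andP[_ /eqP Ei].
  by have := ltn_ord (fill f c); rewrite Ei ltnNge ik.
have <- : boundary f i.+1 j - boundary f i j = f j.+1 i - f j i.
  have := boundaryS i jk; have := gt_leS i fG jk; lia.
rewrite -(@card_row_interval j) //.
- apply: eq_card => c; rewrite !inE; case: eqP => //= rc.
  have e1 := fill_ltE c ik; have e2 := fill_ltE c (ltnW ik).
  by rewrite eqn_leq -ltnS [in X in _ && X]leqNgt e1 e2 rc -leqNgt andbC.
- by rewrite -boundary0 boundary_mono.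
- by rewrite -boundaryk // boundary_mono.
Qed.

Lemma tab_pattern_fill : tab_pattern (fill f) = f.
Proof.
have [f0 _ fo _] := fG; apply/funext => j; apply/funext => i.
case: (leqP j k) => jk; last by rewrite /tab_pattern leqNgt jk fo.
elim: j jk => [|j IH] jk.
  by rewrite /tab_pattern f0; apply: eq_card0 => c; rewrite !inE ltn0.
rewrite tab_patternS // IH ?(ltnW jk) // row_count_fill // subnKC //.
exact: gt_leS fG jk.
Qed.

Lemma boundary_step n m : n.+1 < k -> boundary f m.+1 n.+1 <= boundary f m n.
Proof.
move=> nk; have := fD m nk; rewrite /dom_at /dominates /boundary.
have le a b : a < k -> psum (f a) b <= psum (f a.+1) b.
  by move=> ak; apply: leq_sum => q _; exact: gt_leS fG ak.
by have := le n m (ltnW nk); have := le n.+1 m.+1 nk; lia.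
Qed.

(** Each row upwards costs one diagonal [boundary_step], from [i] to [i.-1], which monotonicity in
    the entry makes good. *)
Lemma boundary_anti j j' i : j <= j' -> j' < k ->
  boundary f i j' <= boundary f i j.
Proof.
elim: j' => [|j' IH]; first by rewrite leqn0 => /eqP ->.
rewrite leq_eqVlt => /orP[/eqP -> //|jj' jk].
apply: leq_trans (IH jj' (ltnW jk)); case: i {IH} => [|i].
  by rewrite !boundary0 L_dec.
exact: leq_trans (boundary_step _ jk) (boundary_mono (ltnW jk) (leqnSn i)).
Qed.

Lemma fill_semistandard : semistandard (fill f).
Proof.
apply: semistandardP => c d.
  move=> rE cE; rewrite -ltnS fill_ltE // rE.
  by apply: leq_ltn_trans cE _; rewrite -fill_ltE.
move=> cE rE; have rk := row_lt d; have dk := ltn_ord (fill f d).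
rewrite fill_ltE ?(ltnW dk) // cE.
have : col d < boundary f (fill f d).+1 (row d) by rewrite -fill_ltE.
case: (row d) rE rk => // r; rewrite ltnS => rE rk /leq_trans; apply.
exact: leq_trans (boundary_step _ rk) (boundary_anti _ rE (ltnW rk)).
Qed.

End Fill.

Variable eps : k.-tuple nat.
Notation E := (nth 0 eps).

Lemma nth_tuple_out i : k <= i -> E i = 0.
Proof. by move=> ki; rewrite nth_default ?size_tuple. Qed.

Definition LR_tableau T :=
  [&& semistandard T, has_weight T eps & lattice_word k (reading_word T)].

Definition LR_pattern f :=
  dominant k L f /\ forall j, j < k -> L j + weight k f j = G j.

Lemma tab_pattern_top T i : has_weight T eps -> tab_pattern T k i = E i.
Proof.
move=> /forallP wT; rewrite /tab_pattern leqnn; case: (ltnP i k) => ik.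
  have /eqP := wT (Ordinal ik); rewrite (tnth_nth 0) /= => <-.
  by apply: eq_card => c; rewrite !inE row_lt.
rewrite nth_tuple_out //; apply: eq_card0 => c; rewrite !inE.
by apply/negbTE/nandP; right; have := ltn_ord (T c); lia.
Qed.

Lemma tab_pattern_gt T : LR_tableau T -> gt_pattern k E (tab_pattern T).
Proof.
case/and3P => ssT wT lT; split=> [i|i|j i kj|j jk i].
- by apply: eq_card0 => c; rewrite !inE ltn0.
- exact: tab_pattern_top.
- by rewrite /tab_pattern leqNgt kj.
- by rewrite lattice_interlace //= tab_patternS // leq_addr.
Qed.

Lemma tab_pattern_LR T : LR_tableau T -> LR_pattern (tab_pattern T).
Proof.
case/and3P => ssT wT lT; split; first exact: tab_pattern_dominant.
by move=> j jk; rewrite -(row_total T jk) /weight psum_tab_patternS // addKn.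
Qed.

Lemma tab_patternK T : LR_tableau T -> fill (tab_pattern T) = T.
Proof.
move=> LT; have TG := tab_pattern_gt LT; have [_ TW] := tab_pattern_LR LT.
have ssT : semistandard T by case/and3P: LT.
apply/ffunP => c; apply: val_inj.
have lt i : i <= k -> (fill (tab_pattern T) c < i) = (T c < i).
  move=> ik; rewrite (fill_ltE TG TW) // (entry_ltE _ _ ssT).
  by rewrite boundary_tab_pattern ?row_lt.
have := lt (T c).+1 (ltn_ord _); have := lt (fill (tab_pattern T) c).+1 (ltn_ord _).
by rewrite /= ltnSn ltnSn; lia.
Qed.

Lemma fill_LR f : gt_pattern k E f -> LR_pattern f -> LR_tableau (fill f).
Proof.
move=> fG [fD fW]; have tE := tab_pattern_fill nth_tuple_out fG fW.
apply/and3P; split.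
- exact: fill_semistandard fG fD fW.
- apply/forallP => a; apply/eqP; rewrite (tnth_nth 0).
  have [_ <- _ _] := fG; rewrite -{2}tE /tab_pattern leqnn.
  by apply: eq_card => c; rewrite !inE row_lt.
- apply: interlace_lattice; rewrite tE => j jk.
  by have [_ _ _ fI] := fG; exact: fI.
Qed.

Lemma card_LR_tableaux :
  #|[pred T | LR_tableau T]| =
  #|[pred x : pattern k E |
      `[< gt_pattern k E (pat_fun x) /\ LR_pattern (pat_fun x) >]]|.
Proof.
rewrite -!sum1_card.
rewrite (reindex_onto (fun x : pattern k E => fill (pat_fun x))
                      (fun T => pat_of k E (tab_pattern T))) /=.
  apply: eq_bigl => x; rewrite !inE; apply/andP/asboolP => [[LT /eqP <-]|[xG xP]].
    rewrite (pat_ofK nth_tuple_out (tab_pattern_gt LT)).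
    by split; [exact: tab_pattern_gt|exact: tab_pattern_LR].
  rewrite fill_LR // (tab_pattern_fill nth_tuple_out xG) ?pat_funK //.
  by case: xP.
move=> T; rewrite inE => LT.
by rewrite (pat_ofK nth_tuple_out (tab_pattern_gt LT)) tab_patternK.
Qed.

End Tableaux.

(** * Strictly increasing tuples *)

Definition rev_tuple_of (k : nat) (u : 'I_k -> nat) : k.-tuple nat :=
  [tuple u (rev_ord j) | j < k].

Lemma rev_ord_val k (j : 'I_k) : k - (rev_ord j).+1 = j.
Proof. by rewrite /=; have := ltn_ord j; lia. Qed.

Lemma sumn_tuple k (t : k.-tuple nat) : sumn t = \sum_(i < k) tnth t i.
Proof. by rewrite sumnE big_tuple. Qed.

Lemma sum_rev_ord k (F : 'I_k -> nat) : \sum_(i < k) F (rev_ord i) = \sum_(i < k) F i.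
Proof. by rewrite [RHS](reindex_inj rev_ord_inj). Qed.

Lemma nth_tnth k (t : k.-tuple nat) j (jk : j < k) : nth 0 t j = tnth t (Ordinal jk).
Proof. by rewrite (tnth_nth 0). Qed.

Section StrictTuple.
Variables (k : nat) (v : k.-tuple nat).
Hypothesis v_inc : sorted ltn v.

Lemma strict_tuple_gap (i j : 'I_k) : i <= j -> tnth v i + (j - i) <= tnth v j.
Proof.
rewrite !(tnth_nth 0); have := ltn_ord j; move: (nat_of_ord i) (nat_of_ord j).
move=> a b bk ab; rewrite -{2}(subnKC ab).
have : a + (b - a) < k by lia.
elim: (b - a) => [|n IH] nk; first by rewrite !addn0.
have /IH le : a + n < k by lia.
have : nth 0 v (a + n) < nth 0 v (a + n.+1).
  by apply: (sorted_ltn_nth ltn_trans 0 v_inc); rewrite ?inE ?size_tuple; lia.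
by lia.
Qed.

Lemma strict_tuple_ge (j : 'I_k) : j <= tnth v j.
Proof.
have k0 : 0 < k by exact: leq_ltn_trans (ltn_ord j).
by have := @strict_tuple_gap (Ordinal k0) j isT; rewrite /=; lia.
Qed.

Lemma gamma_of_rev (j : 'I_k) : tnth (gamma_of v) (rev_ord j) + j = tnth v j.
Proof. by rewrite tnth_mktuple rev_ordK subnK // strict_tuple_ge. Qed.

Lemma gamma_of_dec j : j.+1 < k ->
  nth 0 (gamma_of v) j.+1 <= nth 0 (gamma_of v) j.
Proof.
move=> jk; rewrite (nth_tnth _ jk) (nth_tnth _ (ltnW jk)) !tnth_mktuple.
set b := rev_ord _; set a := rev_ord _.
have ab : a = b.+1 :> nat by rewrite /=; lia.
have := @strict_tuple_gap b a; have := strict_tuple_ge b; lia.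
Qed.

End StrictTuple.

(** Adding delta to [lam + w = gamma] and reversing gives the tuple [v]. If [lam] is not contained
    in [gamma], no weight solves this equation and both sides are zero. *)
Lemma LR_coefE k (lam eps v : k.-tuple nat) :
  (forall j, j.+1 < k -> nth 0 lam j.+1 <= nth 0 lam j) -> sorted ltn v ->
  LR_coef (gamma_of v) lam eps =
  #|[pred x : pattern k (nth 0 eps) |
     `[< gt_pattern k (nth 0 eps) (pat_fun x) /\
         (dominant k (nth 0 lam) (pat_fun x) /\
          rev_tuple_of (shifted_weight (nth 0 lam) (pat_fun x)) = v) >]]|.
Proof.
move=> lam_dec v_inc; set gam := gamma_of v.
have LRv f : (forall j, j < k -> nth 0 lam j + weight k f j = nth 0 gam j) <->
    rev_tuple_of (shifted_weight (nth 0 lam) f) = v.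
  split=> [fW|E j jk].
    apply: eq_from_tnth => j; rewrite tnth_mktuple /shifted_weight rev_ord_val.
    by rewrite fW // -(gamma_of_rev v_inc) (tnth_nth 0).
  have Ev : tnth v (rev_ord (Ordinal jk)) = shifted_weight (nth 0 lam) f (Ordinal jk).
    by rewrite -E tnth_mktuple rev_ordK.
  have := gamma_of_rev v_inc (rev_ord (Ordinal jk)).
  rewrite rev_ordK Ev /shifted_weight -/gam (tnth_nth 0) /=; lia.
rewrite /LR_coef; case: ifP => [/forallP LG|/negP nLG].
  have LG' j : nth 0 lam j <= nth 0 gam j.
    case: (ltnP j k) => jk; first by rewrite !(nth_tnth _ jk).
    by rewrite nth_default // size_tuple.
  rewrite (card_LR_tableaux lam_dec (gamma_of_dec v_inc) LG' eps).
  apply: eq_card => x; rewrite !inE; apply/asboolP/asboolP => -[xG [xD /LRv xW]]//.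
apply/esym/eq_card0 => x; rewrite !inE; apply/asboolPn => -[_ [_ /LRv xW]].
apply: nLG; apply/forallP => i; rewrite !(tnth_nth 0) -xW //; exact: leq_addr.
Qed.

(** * The increasing tuple attached to a dominant pattern *)

Section DominantPattern.
Variables (k : nat) (lam eps : k.-tuple nat) (f : nat -> nat -> nat).
Hypothesis fG : gt_pattern k (nth 0 eps) f.
Hypothesis fD : dominant k (nth 0 lam) f.

Notation L := (nth 0 lam).
Notation E := (nth 0 eps).

Lemma boundary_weight j : boundary lam f k j = L j + weight k f j.
Proof. by []. Qed.

Lemma dominant_dec j : j.+1 < k -> L j.+1 + weight k f j.+1 <= L j + weight k f j.
Proof.
move=> jk; have := boundary_step fG fD k jk.
rewrite -!boundary_weight; apply: leq_trans.
exact (boundary_mono lam fG jk (leqnSn k)).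
Qed.

(** Entries [j] lie in distinct columns. [key] quantifies this: the entries [j] of the rows up to
    [n], placed after the entries [< j] of row [n], fit before the end of the entries [<= j] of row
    [j]. *)
Lemma dominant_ge j : j < k -> E j <= L j + weight k f j.
Proof.
move=> jk; have [_ fk _ _] := fG.
have base : boundary lam f j.+1 j = boundary lam f j j + f j.+1 j.
  by have := boundaryS lam fG j jk; rewrite (gt_tri fG (leqnn j)) addn0.
have key n : j <= n -> n < k ->
    f n.+1 j + boundary lam f j n <= boundary lam f j.+1 j.
  elim: n => [|n IH]; first by rewrite leqn0 => /eqP j0 _; rewrite base j0 addnC.
  rewrite leq_eqVlt => /orP[/eqP <- _|]; first by rewrite base addnC.
  rewrite ltnS => jn nk; apply: leq_trans (IH jn (ltnW nk)).
  by have := boundary_step fG fD j nk; have := boundaryS lam fG j nk; lia.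
have k1 : k.-1 < k by lia.
have jk1 : j <= k.-1 by lia.
have := key k.-1 jk1 k1; rewrite prednK ?fk => [le|]; last by lia.
rewrite -boundary_weight.
by have := boundary_mono lam fG jk jk; lia.
Qed.

(** The first row contains only the smallest entry, since level 1 has a single index that can be
    nonzero. *)
Lemma weight_first_le : 0 < k -> weight k f 0 <= E 0.
Proof.
move=> k0; have [f0 _ _ _] := fG.
have e0 : psum (f 0) k = 0 by rewrite /psum big1.
have e1 : psum (f 1) k = f 1 0.
  rewrite /psum (bigD1 (Ordinal k0)) //= big1 ?addn0 // => i i0.
  by apply: (gt_tri fG); rewrite lt0n; move: i0; rewrite -(inj_eq val_inj).
by rewrite /weight e0 e1 subn0 (gt_le_top 0 fG k0).
Qed.

Lemma sum_weight : \sum_(j < k) weight k f j = psum E k.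
Proof.
have [f0 fk _ _] := fG.
have part n : n <= k -> \sum_(j < n) weight k f j = psum (f n) k.
  elim: n => [|n IH] nk; first by rewrite big_ord0 /psum big1.
  by rewrite big_ord_recr /= IH ?(ltnW nk) // (psum_weight fG nk).
by rewrite part //; apply: eq_psum => i _.
Qed.

Definition dominant_tuple : k.-tuple nat := rev_tuple_of (shifted_weight L f).

Lemma tnth_dominant_tuple j :
  tnth dominant_tuple j = L (rev_ord j) + weight k f (rev_ord j) + j.
Proof. by rewrite tnth_mktuple /shifted_weight rev_ord_val. Qed.

Lemma dominant_tuple_strict : sorted ltn dominant_tuple.
Proof.
apply/(sortedP 0) => i; rewrite size_tuple => ik.
rewrite (nth_tnth _ ik) (nth_tnth _ (ltnW ik)) !tnth_dominant_tuple /=.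
have jk : (k - i.+2).+1 < k by lia.
have := dominant_dec jk; rewrite (_ : (k - i.+2).+1 = k - i.+1); last by lia.
by rewrite /ltn /=; lia.
Qed.

Lemma dominant_tuple_Vstar (r : k.-tuple nat) :
  sorted ltn r -> eps = epsilon_of r -> Vstar lam r dominant_tuple.
Proof.
move=> r_inc epsE; set v := dominant_tuple.
have rE j : tnth r j = E (rev_ord j) + j.
  by rewrite -(gamma_of_rev r_inc) epsE (tnth_nth 0).
have rv j : tnth r j <= tnth v j.
  by rewrite tnth_dominant_tuple rE leq_add2r dominant_ge.
(* As [v] is already increasing, no sorting interferes and [v - r] is the rearrangement sought; its
   sum is that of [lam] because [r] is [eps + delta] reversed. *)
pose p : k.-tuple nat := [tuple tnth v j - tnth r j | j < k].
have pr : tuple_add p r = v.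
  by apply: eq_from_tnth => j; rewrite tnth_mktuple [tnth p j]tnth_mktuple subnK.
have sump : sumn p = sumn lam.
  have : sumn v = sumn p + sumn r.
    rewrite -pr !sumn_tuple -big_split /=; apply: eq_bigr => j _.
    by rewrite tnth_mktuple.
  have -> : sumn v = sumn lam + psum E k + \sum_(j < k) j.
    rewrite !sumn_tuple -sum_weight.
    rewrite -(sum_rev_ord (tnth lam)) -(sum_rev_ord (fun j => weight k f j)).
    rewrite -!big_split /=; apply: eq_bigr => j _.
    by rewrite tnth_dominant_tuple (tnth_nth 0).
  have -> : sumn r = psum E k + \sum_(j < k) j.
    rewrite sumn_tuple /psum -(sum_rev_ord (fun j => E j)) -big_split /=.
    by apply: eq_bigr => j _.
  by lia.
exists [tuple of sort geq p], p; split.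
- split; first by apply: sort_sorted => a b; exact: leq_total.
  by rewrite -sump; apply: perm_sumn; rewrite perm_sort.
- by rewrite /rearrangements /= perm_sym perm_sort.
- rewrite pr; apply: val_inj => /=; rewrite sorted_sort //; first exact: leq_trans.
  exact: sub_sorted ltnW _ dominant_tuple_strict.
- exact: dominant_tuple_strict.
Qed.

End DominantPattern.

(** * Partitions attached to increasing index maps *)

Section Increasing.
Variables (k m : nat) (f : 'I_k -> 'I_m).
Hypothesis f_inc : increasing f.

Lemma one_based_strict : sorted ltn (one_based f).
Proof.
apply/(sortedP 0) => i; rewrite size_tuple => ik.
rewrite (nth_tnth _ ik) (nth_tnth _ (ltnW ik)) !tnth_mktuple /=.
by rewrite ltnS; apply: f_inc.
Qed.

Lemma tnth_one_based_gt (j : 'I_k) : j < tnth (one_based f) j.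
Proof.
have k0 : 0 < k by exact: leq_ltn_trans (ltn_ord j).
have := @strict_tuple_gap _ _ one_based_strict (Ordinal k0) j isT.
by rewrite tnth_mktuple /=; lia.
Qed.

Lemma lambda_of_one_based (j : 'I_k) :
  nth 0 (lambda_of (one_based f)) (rev_ord j) + j = f j.
Proof.
rewrite -(tnth_nth 0 _ (rev_ord j)) !tnth_mktuple rev_ordK.
by have := tnth_one_based_gt j; rewrite tnth_mktuple; lia.
Qed.

Lemma lambda_of_dec j : j.+1 < k ->
  nth 0 (lambda_of (one_based f)) j.+1 <= nth 0 (lambda_of (one_based f)) j.
Proof.
move=> jk; have := lambda_of_one_based (rev_ord (Ordinal jk)).
have := lambda_of_one_based (rev_ord (Ordinal (ltnW jk))).
rewrite !rev_ordK /=.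
have : f (rev_ord (Ordinal jk)) < f (rev_ord (Ordinal (ltnW jk))).
  by apply: f_inc => /=; lia.
by lia.
Qed.

Lemma epsilon_of_one_based (j : 'I_k) :
  nth 0 (epsilon_of (one_based f)) (rev_ord j) + j = (f j).+1.
Proof.
rewrite -(tnth_nth 0 _ (rev_ord j)) (gamma_of_rev one_based_strict).
by rewrite tnth_mktuple.
Qed.

Lemma epsilon_of_dec j :
  nth 0 (epsilon_of (one_based f)) j.+1 <= nth 0 (epsilon_of (one_based f)) j.
Proof.
case: (ltnP j.+1 k) => jk; first exact: gamma_of_dec one_based_strict _ jk.
by rewrite nth_default // size_tuple.
Qed.

End Increasing.

Local Open Scope ring_scope.

(** * Expansion of the Hankel minors *)

Section Expansion.
Variables (C : numDomainType) (g : int -> C) (M N k : nat).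
Variables (s : 'I_k -> 'I_M) (r : 'I_k -> 'I_N).
Hypotheses (s_inc : increasing s) (r_inc : increasing r).

Let lam := lambda_of (one_based s).
Let eps := epsilon_of (one_based r).
Let b (v : k.-tuple nat) := bdet g (map_tuple Posz v).

Lemma det_hankel_gt_sum :
  \det (mxsub s r (hankel g 1 M N)) =
  gt_sum k (nth 0%N eps) (dominant k (nth 0%N lam))
    (fun f => b (dominant_tuple lam f)).
Proof.
(* The argument [n] will be a 1-based column index and [s l] is a 0-based row index, which absorbs
   the offset 1 of the Hankel matrix. *)
pose h (l : 'I_k) (n : nat) := g (n%:Z + (s l)%:Z).
pose h' (l : 'I_k) (n : nat) := g (n%:Z + l%:Z).
have bE u : b (rev_tuple_of u) = \det (\matrix_(l, j) h' l (u (rev_ord j))).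
  congr (\det _); apply/matrixP => l j; rewrite !mxE tnth_map.
  by rewrite tnth_mktuple.
rewrite /dominant_tuple -(@gt_sum_dominant _ _ (@nth_tuple_out _ eps) _ (lambda_of_dec s_inc) _
  (fun u => b (rev_tuple_of u))); last first.
  by move=> u i j ij; rewrite !bE det_rev_alt.
transitivity (\det (\matrix_(l, j) h l (nth 0%N eps (rev_ord j) + j)%N)).
  congr (\det _); apply/matrixP => l j; rewrite !mxE /h epsilon_of_one_based //.
  by congr g; lia.
(* In the transposed form weight and row index share column [j], where they merge into
   [lam + w + delta]. *)
rewrite (bialternant_tr (@nth_tuple_out _ eps) (epsilon_of_dec r_inc)).
apply: eq_gt_sum => // f fG _; rewrite bE; congr (\det _).
apply/matrixP => l j; rewrite !mxE /h /h' /shifted_weight rev_ord_val.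
by have := lambda_of_one_based s_inc j; rewrite -/lam => <-; congr g; lia.
Qed.

Lemma det_hankel_LR :
  \det (mxsub s r (hankel g 1 M N)) =
  \sum_(v \in Vstar lam (one_based r)) (LR_coef (gamma_of v) lam eps)%:R * b v.
Proof.
rewrite det_hankel_gt_sum fsbig_finite; last exact: finite_Vstar.
pose V (x : pattern k (nth 0%N eps)) := dominant_tuple lam (pat_fun x).
pose A (x : pattern k (nth 0%N eps)) := `[< gt_pattern k (nth 0%N eps) (pat_fun x) /\
                dominant k (nth 0%N lam) (pat_fun x) >].
(* Patterns are grouped by their tuple; since each tuple lies in [Vstar], none is lost. *)
transitivity (\sum_(v <- fset_set (Vstar lam (one_based r)))
    \sum_(x | A x) (if V x == v then b v else 0)).
  rewrite exchange_big; apply: eq_bigr => x /asboolP[xG xD].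
  have xV : Vstar lam (one_based r) (V x).
    exact (dominant_tuple_Vstar xG xD (one_based_strict r_inc) erefl).
  rewrite (bigD1_seq (V x)) ?fset_uniq //=; last first.
    by rewrite in_fset_set ?inE //; exact: finite_Vstar.
  by rewrite eqxx big1 ?addr0 // => v /negbTE; rewrite eq_sym => ->.
apply: eq_big_seq => v; rewrite in_fset_set ?inE; last exact: finite_Vstar.
move=> [mu [p [_ _ _ v_inc]]].
rewrite (LR_coefE _ (lambda_of_dec s_inc) v_inc) -sum1_card natr_sum mulr_suml.
rewrite -big_mkcondr /=; apply: eq_big => [x|x _]; last by rewrite mul1r.
rewrite inE; apply/andP/asboolP => [[/asboolP[? ?] /eqP ?]//|[xG [xD xE]]].
by split; [apply/asboolP|apply/eqP].
Qed.

End Expansion.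

(** * Transfer of sign consistency *)

Section SignConsistency.
Variables (C : numDomainType) (g : int -> C) (k : nat).

Let b (v : k.-tuple nat) := bdet g (map_tuple Posz v).

(** A minor of order [k] of a matrix with [k] rows is therefore determined by its columns. *)
Lemma increasing_id (f : 'I_k -> 'I_k) : increasing f -> forall i, f i = i.
Proof.
move=> f_inc i; apply: val_inj => /=.
have ik := ltn_ord i; have mk : (k.-1 < k)%N by lia.
have lo := tnth_one_based_gt f_inc i; rewrite tnth_mktuple in lo.
have im : (i <= Ordinal mk)%N by rewrite /=; lia.
have := strict_tuple_gap (one_based_strict f_inc) im.
rewrite !tnth_mktuple; have := ltn_ord (f (Ordinal mk)).
by rewrite [nat_of_ord (Ordinal mk)]/=; lia.
Qed.

Lemma one_based_increasing_tuples m (f : 'I_k -> 'I_m) :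
  increasing f -> increasing_tuples k m (one_based f).
Proof.
move=> f_inc; split; first exact: one_based_strict.
by apply/allP => _ /mapP[j _ ->] /=.
Qed.

Lemma minor_hankel_bdet m f : minor_indices k k m f ->
  minor (hankel g 1 k m) f = b (one_based f.2).
Proof.
move=> [f1_inc _]; congr (\det _); apply/matrixP => l j.
rewrite !mxE (increasing_id f1_inc) tnth_map tnth_mktuple.
by congr g; lia.
Qed.

Lemma bdet_minor_hankel m v : increasing_tuples k m v ->
  exists2 f, minor_indices k k m f & minor (hankel g 1 k m) f = b v.
Proof.
move=> [v_inc /allP v_bnd].
have bnd j : (0 < tnth v j <= m)%N by exact: v_bnd (mem_tnth j v).
have vm j : ((tnth v j).-1 < m)%N by have := bnd j; lia.
have fP : minor_indices k k m (id, fun j => Ordinal (vm j)).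
  split=> // i j ij /=; have := bnd i.
  by have := strict_tuple_gap v_inc (ltnW ij); lia.
exists (id, fun j => Ordinal (vm j)) => //; rewrite minor_hankel_bdet //.
congr b; apply: eq_from_tnth => j; rewrite tnth_mktuple /=.
by have := bnd j; lia.
Qed.

Lemma sign_consistent_bdet m :
  sign_consistent k (hankel g 1 k m) <-> share_sign (increasing_tuples k m) b.
Proof.
split=> -[] h; [left|right|left|right].
- by move=> v /bdet_minor_hankel[f /h + <-].
- by move=> v /bdet_minor_hankel[f /h + <-].
- by move=> f fP; rewrite minor_hankel_bdet //; apply: h;
    case: fP => _; exact: one_based_increasing_tuples.
- by move=> f fP; rewrite minor_hankel_bdet //; apply: h;
    case: fP => _; exact: one_based_increasing_tuples.
Qed.

Lemma strictly_sign_consistent_bdet m :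
  strictly_sign_consistent k (hankel g 1 k m) <->
  share_strict_sign (increasing_tuples k m) b.
Proof.
split=> -[] h; [left|right|left|right].
- by move=> v /bdet_minor_hankel[f /h + <-].
- by move=> v /bdet_minor_hankel[f /h + <-].
- by move=> f fP; rewrite minor_hankel_bdet //; apply: h;
    case: fP => _; exact: one_based_increasing_tuples.
- by move=> f fP; rewrite minor_hankel_bdet //; apply: h;
    case: fP => _; exact: one_based_increasing_tuples.
Qed.

Section Minors.
Variables (M N : nat) (s : 'I_k -> 'I_M) (r : 'I_k -> 'I_N).
Hypotheses (s_inc : increasing s) (r_inc : increasing r).

Let lam := lambda_of (one_based s).
Let eps := epsilon_of (one_based r).
Let D := increasing_tuples k (M + N - k).

(** In 1-based terms, entry [j] is at least [r_j >= 1], and the largest entry is at most [lam_1 +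
    eps_1 + k - 1 = s_k + r_k - k <= M + N - k]. *)
Lemma dominant_tuple_increasing f :
  gt_pattern k (nth 0%N eps) f -> dominant k (nth 0%N lam) f ->
  D (dominant_tuple lam f).
Proof.
move=> fG fD; have v_inc := dominant_tuple_strict fG fD; split=> //.
apply/allP => _ /tnthP[j ->]; have jk := ltn_ord j.
have := dominant_ge fG fD (ltn_ord (rev_ord j)).
have k0 : (0 < k)%N by lia.
have mk : (k.-1 < k)%N by lia.
have := strict_tuple_gap v_inc (i := j) (j := Ordinal mk).
have r0 : rev_ord (Ordinal mk) = Ordinal k0 by apply: val_inj => /=; lia.
have := epsilon_of_one_based r_inc j; have := epsilon_of_one_based r_inc (Ordinal mk).
have := lambda_of_one_based s_inc (Ordinal mk); have := weight_first_le fG k0.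
have := ltn_ord (r (Ordinal mk)); have := ltn_ord (s (Ordinal mk)).
rewrite -/lam -/eps !tnth_dominant_tuple r0 [nat_of_ord (Ordinal mk)]/= [nat_of_ord (Ordinal k0)]/=.
lia.
Qed.

(** The factor [c] is later 1 or -1, so that one argument serves both signs. *)
Lemma minor_hankel_ge0 (c : C) : (forall v, D v -> 0 <= c * b v) ->
  0 <= c * minor (hankel g 1 M N) (s, r).
Proof.
move=> b_ge0; rewrite /minor (det_hankel_gt_sum g s_inc r_inc) /gt_sum mulr_sumr.
by apply: sumr_ge0 => x /asboolP[xG xD]; apply/b_ge0/dominant_tuple_increasing.
Qed.

Lemma minor_hankel_gt0 (c : C) : (forall v, D v -> 0 < c * b v) ->
  0 < c * minor (hankel g 1 M N) (s, r).
Proof.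
move=> b_gt0; rewrite /minor (det_hankel_gt_sum g s_inc r_inc) /gt_sum mulr_sumr.
have tG := top_pattern_gt (@nth_tuple_out _ eps) (epsilon_of_dec r_inc).
have tD := top_pattern_dominant (epsilon_of_dec r_inc) (lambda_of_dec s_inc).
(* The sum is not empty: [top_pattern] is dominant for every decreasing [lam] and supplies a
   strictly positive term. *)
rewrite (bigD1 (pat_of k (nth 0%N eps) (top_pattern k (nth 0%N eps)))); last first.
  by apply/asboolP; rewrite (pat_ofK (@nth_tuple_out _ eps) tG).
rewrite ltr_wpDr //.
  apply: sumr_ge0 => x /andP[/asboolP[xG xD] _].
  by apply/ltW/b_gt0/dominant_tuple_increasing.
by rewrite (pat_ofK (@nth_tuple_out _ eps) tG); apply/b_gt0/dominant_tuple_increasing.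
Qed.

End Minors.
End SignConsistency.

Theorem theorem2 (R : realType) (g : int -> R[i]) (M N k : nat)
    (k_gt0 : (0 < k)%N) (k_le : (k <= minn M N)%N) :
  let A := hankel g 1 M N in
  let H := hankel g 1 k (M + N - k) in
  let b := fun v : k.-tuple nat => bdet g (map_tuple Posz v) in
  [/\ forall (s : 'I_k -> 'I_M) (r : 'I_k -> 'I_N),
        increasing s -> increasing r ->
        let lam := lambda_of (one_based s) in
        let eps := epsilon_of (one_based r) in
        \det (mxsub s r A) =
          \sum_(v \in Vstar lam (one_based r))
             (LR_coef (gamma_of v) lam eps)%:R * b v,
      (sign_consistent k H <->
         share_sign (increasing_tuples k (M + N - k)) b) /\
      (strictly_sign_consistent k H <->
         share_strict_sign (increasing_tuples k (M + N - k)) b),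
      sign_consistent k H -> sign_consistent k A
    & strictly_sign_consistent k H -> strictly_sign_consistent k A].
Proof.
move=> A H b; split.
- by move=> s r s_inc r_inc lam eps; exact: det_hankel_LR.
- split; first exact: sign_consistent_bdet.
  exact: strictly_sign_consistent_bdet.
- case/sign_consistent_bdet => h; [left|right] => -[s r] [s_inc r_inc].
    rewrite -[minor _ _]mul1r; apply: (minor_hankel_ge0 s_inc r_inc) => v vD.
    by rewrite mul1r; exact: h.
  rewrite -oppr_ge0 -mulN1r; apply: (minor_hankel_ge0 s_inc r_inc) => v vD.
  by rewrite mulN1r oppr_ge0; exact: h.
- case/strictly_sign_consistent_bdet => h; [left|right] => -[s r] [s_inc r_inc].
    rewrite -[minor _ _]mul1r; apply: (minor_hankel_gt0 s_inc r_inc) => v vD.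
    by rewrite mul1r; exact: h.
  rewrite -oppr_gt0 -mulN1r; apply: (minor_hankel_gt0 s_inc r_inc) => v vD.
  by rewrite mulN1r oppr_gt0; exact: h.
Qed.
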